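(* Let $\sigma,\sigma'\in\{+,-\}^{n-1}$. The Hohlweg--Lange associahedra $\mathrm{Ass}^{\mathrm I}_n(\sigma)$ and $\mathrm{Ass}^{\mathrm I}_n(\sigma')$ are normally isomorphic if and only if they are isometric.
   Context: **Normal isomorphism.** Two complete fans in real vector spaces $V,V'$ of the same dimension are linearly isomorphic if there is a linear isomorphism $V\to V'$ sending each cone of one fan to a cone of the other. Two polytopes are normally isomorphic if their normal fans are linearly isomorphic. (For a polytope that is not full-dimensional in its ambient space, the normal fan is taken modulo its lineality space, i.e. the polytope is considered as full-dimensional in its affine hull.) Two polytopes are isometric if some isometry (for the Euclidean metric) maps one onto the other. **Hohlweg--Lange associahedra.** For $\sigma\in\{+,-\}^{n-1}$ let $\widetilde\sigma=(+,-,\sigma,-,+)$, a sequence of $n+3$ signs indexed by $0,1,\dots,n+2$. Let $P_{n+3}(\sigma)$ be a convex $(n+3)$-gon with vertices labelled $0,1,\dots,n+2$ from left to right (increasing first coordinate), with the vertices of sign $+$ placed above a fixed horizontal line and those of sign $-$ placed below it. For an (internal) diagonal $ij$ ($i<j$) of $P_{n+3}(\sigma)$, let $R_{ij}(\sigma)$ be the set of vertices strictly below it, and let $S_{ij}(\sigma)$ be obtained from $R_{ij}(\sigma)$ by replacing $0$ by $i$ if $0\in R_{ij}(\sigma)$ and replacing $n+2$ by $j$ if $n+2\in R_{ij}(\sigma)$. Then $$\mathrm{Ass}^{\mathrm I}_n(\sigma)=\Big\{x\in\mathbb R^{n+1}:\ \sum_{i\in S_\delta(\sigma)}x_i\ge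 \tfrac12|S_\delta(\sigma)|(|S_\delta(\sigma)|+1)\text{ for all diagonals }\delta,\ \ x_1+\cdots+x_{n+1}=\tfrac{(n+1)(n+2)}2\Big\}.$$ *)

(* Defs.v *)
(* Mathematical Components, with the real numbers as an abstract realType. *)
From HB Require Import structures.
From mathcomp Require Export all_boot all_order all_algebra.
From mathcomp Require Export boolp classical_sets reals.
From mathcomp Require Import ring lra.

Set Implicit Arguments.
Unset Strict Implicit.
Unset Printing Implicit Defensive.
Import Order.TTheory GRing.Theory Num.Theory.

Local Open Scope classical_set_scope.
Local Open Scope ring_scope.

(** * Normal fans *)

(* The linear space parallel to the affine hull of A: the smallest subspace
   containing all differences of points of A (see [dirspaceP]). *)
Definition dirspace (R : realType) (V : vectType R) (A : set V) : {vspace V} :=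
  xget fullv [set U : {vspace V} |
    (forall x y, A x -> A y -> y - x \in U) /\
    (forall W : {vspace V},
       (forall x y, A x -> A y -> y - x \in W) -> (U <= W)%VS)].

Lemma dirspaceP (R : realType) (V : vectType R) (A : set V) :
  (forall x y, A x -> A y -> y - x \in dirspace A) /\
  (forall W : {vspace V},
     (forall x y, A x -> A y -> y - x \in W) -> (dirspace A <= W)%VS).
Proof.
rewrite /dirspace; case: xgetP => [U _ //|] none; exfalso.
pose Q (U : {vspace V}) := forall x y, A x -> A y -> y - x \in U.
pose D k := `[< exists2 U : {vspace V}, Q U & \dim U = k >].
have exD : exists k, D k.
  exists (\dim {:V}); apply/asboolP; exists fullv => // x y _ _.
  exact: memvf.
have [k /asboolP[U QU dimU] kmin] := ex_minnP exD.
apply: (none U); split=> // W QW.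
have QUW : Q (U :&: W)%VS by move=> x y Ax Ay; rewrite memv_cap QU ?QW.
have : (k <= \dim (U :&: W))%N by apply: kmin; apply/asboolP; exists (U :&: W)%VS.
rewrite -dimU => le_dim.
have /eqP <- : (U :&: W == U)%VS by rewrite eqEdim capvSl.
exact: capvSr.
Qed.

Definition is_face (R : realType) (V : vectType R) (P F : set V) : Prop :=
  F !=set0 /\
  exists c : 'Hom(V, R^o), F = [set x | P x /\ forall y, P y -> c y <= c x].

(* P is considered as full-dimensional in its affine hull: normal vectors are
   linear functionals on [dirspace P].  This dual space is the quotient of the
   dual of V by the lineality space (the functionals constant on P). *)
Definition normal_space (R : realType) (V : vectType R) (P : set V) :
    vectType R :=
  'Hom(subvs_of (dirspace P), R^o).

Definition normal_cone (R : realType) (V : vectType R) (P F : set V) :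
    set (normal_space P) :=
  [set c : 'Hom(subvs_of (dirspace P), R^o) |
    forall x y, F x -> P y -> c (vsproj (dirspace P) (y - x)) <= 0].
Arguments normal_cone {R V} P F.

Definition normal_fan (R : realType) (V : vectType R) (P : set V) :
    set (set (normal_space P)) :=
  [set C | exists2 F : set V, is_face P F & C = normal_cone P F].
Arguments normal_fan {R V} P.

Definition linearly_isomorphic_fans (R : realType) (V V' : vectType R)
    (Phi : set (set V)) (Phi' : set (set V')) : Prop :=
  exists2 f : 'Hom(V, V'),
    bijective f & forall C : set V, Phi C -> Phi' [set f c | c in C].

Definition normally_isomorphic (R : realType) (V V' : vectType R)
    (P : set V) (P' : set V') : Prop :=
  linearly_isomorphic_fans (normal_fan P) (normal_fan P').

(** * Isometric subsets of Euclidean space *)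

(* The norm of MathComp-Analysis on row vectors is the sup norm. *)
Definition eucl_dist (R : realType) (d : nat) (x y : 'rV[R]_d) : R :=
  Num.sqrt (\sum_(i < d) (x 0 i - y 0 i) ^+ 2).

Definition isometric (R : realType) (d : nat) (P P' : set 'rV[R]_d) : Prop :=
  exists2 g : 'rV[R]_d -> 'rV[R]_d,
    (forall x y, eucl_dist (g x) (g y) = eucl_dist x y) &
    [set g x | x in P] = P'.

(** * The polygons and their diagonals *)

(* Signs are booleans, with [true] for +.  When 0 < n and sigma has length
   n - 1, this sequence has length n + 3. *)
Definition extended_signs (sigma : seq bool) : seq bool :=
  [:: true; false] ++ sigma ++ [:: false; true].

Definition convex_position (R : realType) (m d : nat)
    (p : 'I_m -> 'rV[R]_d) : Prop :=
  forall (k : 'I_m) (w : 'I_m -> R),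
    (forall l, 0 <= w l) -> w k = 0 -> \sum_(l < m) w l = 1 ->
    p k <> \sum_(l < m) w l *: p l.

Definition abscissa (R : realType) (q : 'rV[R]_2) : R := q 0 0.
Definition ordinate (R : realType) (q : 'rV[R]_2) : R := q 0 1.

Definition is_polygon (R : realType) (n : nat) (sigma : seq bool)
    (p : 'I_n.+3 -> 'rV[R]_2) : Prop :=
  [/\ convex_position p,
      forall k l : 'I_n.+3, (k < l)%N -> abscissa (p k) < abscissa (p l) &
      exists h : R, forall k : 'I_n.+3,
        if nth false (extended_signs sigma) k
        then h < ordinate (p k) else ordinate (p k) < h].

(* Negative, zero or positive according to whether r lies to the right of, on,
   or to the left of the line directed from a to b. *)
Definition orientation (R : realType) (a b r : 'rV[R]_2) : R :=
  (abscissa b - abscissa a) * (ordinate r - ordinate a)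
  - (ordinate b - ordinate a) * (abscissa r - abscissa a).

(* For i < j these are the vertices strictly below (resp. above) the line
   through the vertices i and j, which is directed to the right. *)
Definition vertices_below (R : realType) (n : nat)
    (p : 'I_n.+3 -> 'rV[R]_2) (i j : 'I_n.+3) : {set 'I_n.+3} :=
  [set k | orientation (p i) (p j) (p k) < 0].
Definition vertices_above (R : realType) (n : nat)
    (p : 'I_n.+3 -> 'rV[R]_2) (i j : 'I_n.+3) : {set 'I_n.+3} :=
  [set k | 0 < orientation (p i) (p j) (p k)].

(* The segment ij is an edge, rather than an internal diagonal, when all the
   other vertices lie on the same side of it. *)
Definition diagonal (R : realType) (n : nat)
    (p : 'I_n.+3 -> 'rV[R]_2) (i j : 'I_n.+3) : bool :=
  [&& (i < j)%N, vertices_below p i j != finset.set0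
    & vertices_above p i j != finset.set0].

(* [vertices_below] with 0 replaced by i and n + 2 replaced by j. *)
Definition S_set (R : realType) (n : nat)
    (p : 'I_n.+3 -> 'rV[R]_2) (i j : 'I_n.+3) : {set 'I_n.+3} :=
  let B := vertices_below p i j in
  (B :\ ord0 :\ ord_max)
    :|: (if ord0 \in B then [set i]%SET else finset.set0)
    :|: (if ord_max \in B then [set j]%SET else finset.set0).

(** * Hohlweg--Lange associahedra *)

(* The coordinates x_1, ..., x_(n+1) are indexed from 0 here, so that the
   coordinate of index k belongs to the vertex labelled k + 1. *)
Definition coord_label (n : nat) (k : 'I_n.+1) : 'I_n.+3 := inord k.+1.

(* The set is determined by the signs, any polygon p with these signs being
   suitable; such a p exists by [is_polygon_exists]. *)
Definition AssI (R : realType) (n : nat) (p : 'I_n.+3 -> 'rV[R]_2) :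
    set 'rV[R]_(n.+1) :=
  [set x : 'rV[R]_(n.+1) |
    (forall i j : 'I_n.+3, diagonal p i j ->
       \sum_(k < n.+1 | coord_label k \in S_set p i j) x 0 k
         >= 2^-1 * #|S_set p i j|%:R * (#|S_set p i j|%:R + 1)) /\
    \sum_(k < n.+1) x 0 k = n.+1%:R * n.+2%:R / 2].

Lemma is_polygon_exists (R : realType) (n : nat) (sigma : seq bool) :
  exists p : 'I_n.+3 -> 'rV[R]_2, is_polygon sigma p.
Proof.
pose sg (k : nat) := nth false (extended_signs sigma) k.
pose N : R := n.+2%:R.
pose h (x : R) : R := 1 + x * (N - x).
pose y (k : nat) : R := if sg k then h k%:R else - h k%:R.
pose p (k : 'I_n.+3) : 'rV[R]_2 :=
  \row_(j < 2) if j == 0 then k%:R else y k.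
have pa k : abscissa (p k) = k%:R by rewrite /abscissa /p mxE.
have po k : ordinate (p k) = y k by rewrite /ordinate /p mxE.
have h1 (k : 'I_n.+3) : 1 <= h k%:R.
  rewrite /h lerDl mulr_ge0 ?ler0n // subr_ge0 ler_nat.
  by rewrite -ltnS.
exists p; split; last 2 first.
- by move=> k l kl; rewrite !pa ltr_nat.
- exists 0 => k; rewrite po /y -/(sg k).
  have := h1 k; case: (sg k) => hk; first exact: lt_le_trans hk.
  by rewrite oppr_lt0; apply: lt_le_trans hk.
move=> k w w0 wk w1 pk.
pose a : R := 2 * k%:R - N.
(* the linear functional ordinate + c * abscissa exposes p k *)
have expose (e c : R) : (forall l : 'I_n.+3, l != k ->
    0 < e * ((y k + c * k%:R) - (y l + c * l%:R))) -> False.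
  move=> ex.
  have E : \sum_(l < n.+3) w l * (e * ((y k + c * k%:R) - (y l + c * l%:R))) = 0.
    have Ea : k%:R = \sum_(l < n.+3) w l * l%:R :> R.
      have := congr1 (@abscissa R) pk.
      rewrite pa /abscissa summxE => ->; apply: eq_bigr => l _.
      by rewrite mxE -/(abscissa (p l)) pa.
    have Eo : y k = \sum_(l < n.+3) w l * y l.
      have := congr1 (@ordinate R) pk.
      rewrite po /ordinate summxE => ->; apply: eq_bigr => l _.
      by rewrite mxE -/(ordinate (p l)) po.
    transitivity (e * ((y k + c * k%:R) * (\sum_(l < n.+3) w l) -
       ((\sum_(l < n.+3) w l * y l) + c * (\sum_(l < n.+3) w l * l%:R)))).
      rewrite !mulr_sumr -big_split /= -sumrB mulr_sumr.
      apply: eq_bigr => l _.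
      by ring.
    by rewrite w1 -Ea -Eo mulr1 subrr mulr0.
  have nn l : true -> 0 <= w l * (e * ((y k + c * k%:R) - (y l + c * l%:R))).
    move=> _; have [->|lk] := eqVneq l k; first by rewrite wk mul0r.
    by rewrite mulr_ge0 // ltW // ex.
  have wz l : w l = 0.
    have [->//|lk] := eqVneq l k.
    have /eqP := psumr_eq0P nn E (i := l) isT.
    by rewrite mulf_eq0 (gt_eqF (ex l lk)) orbF => /eqP.
  move: w1; rewrite big1 // => /eqP.
  by rewrite eq_sym oner_eq0.
have D (l : 'I_n.+3) : l != k -> 0 < h k%:R - h l%:R + a * (k%:R - l%:R).
  move=> lk; have -> : h k%:R - h l%:R + a * (k%:R - l%:R) = (k%:R - l%:R) ^+ 2.
    by rewrite /h /a; ring.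
  by rewrite exprn_even_gt0 //= subr_eq0 eqr_nat eq_sym.
case sk: (sg k).
- apply: (expose 1 a) => l lk; rewrite /y sk.
  have := D l lk; have := h1 l; case: (sg l); lra.
- apply: (expose (-1) (- a)) => l lk; rewrite /y sk.
  have := D l lk; have := h1 l; case: (sg l); lra.
Qed.

(* Main.v *)
(* Whether k lies below the line ij is decided by signs alone, and the
   coordinate sets cut out by the diagonals are exactly the sets S such that, for
   i < j < k, the coordinate j follows i and k when both lie in S and j is lower,
   or when both lie outside S and j is upper.  The associahedron is obtained from
   the permutahedron by keeping the inequalities indexed by these sets; as the
   centre of a facet of the permutahedron satisfies all the other inequalities
   strictly, each of them is a facet, so the rays of the normal fan are known.

   Write e_S for the functional summing the coordinates in S, modulo the constant
   one.  The pairs of opposite rays are spanned by the n functionals w_k = e_S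
   with S initial.  These form a basis, so a linear isomorphism of fans permutes
   them up to scalars.  Since the number of rays does not depend on the signs, it
   also matches, in both directions, the rays of the form w_b - w_a.  Those
   describe the order relation of a fence, the path 1, ..., n with edges oriented
   by sigma; they force the scalars to be equal and the permutation to be an
   automorphism of the path.  Hence sigma' is sigma up to reversal and negation,
   which are realized by isometries. *)
From HB Require Import structures.
Require Import Defs.
From mathcomp Require Import ring lra zify.

Set Implicit Arguments.
Unset Strict Implicit.
Unset Printing Implicit Defensive.
Import Order.TTheory GRing.Theory Num.Theory.
Local Open Scope classical_set_scope.
Local Open Scope ring_scope.

(** * Diagonals and admissible sets *)

Lemma orientation_swap13 (R : realType) (a b r : 'rV[R]_2) :
  orientation r b a = - orientation a b r.
Proof. by rewrite /orientation; ring. Qed.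

Lemma orientation_swap23 (R : realType) (a b r : 'rV[R]_2) :
  orientation a r b = - orientation a b r.
Proof. by rewrite /orientation; ring. Qed.

Lemma orientation_id1 (R : realType) (a b : 'rV[R]_2) : orientation a b a = 0.
Proof. by rewrite /orientation; ring. Qed.

Lemma orientation_id2 (R : realType) (a b : 'rV[R]_2) : orientation a b b = 0.
Proof. by rewrite /orientation; ring. Qed.

Lemma sum_delta (R : pzRingType) (m : nat) (a : 'I_m) (F : 'I_m -> R) :
  \sum_(l < m) (l == a)%:R * F l = F a.
Proof.
rewrite (bigD1 a) //= eqxx mul1r big1 ?addr0 // => l /negbTE ->.
by rewrite mul0r.
Qed.

(* The vertical line through [b] meets the segments [ac] and [a'c'] on opposite
   sides of [b], which is therefore a convex combination of a, c, a', c'. *)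
Lemma convex_position_between (R : realType) (m : nat) (p : 'I_m -> 'rV[R]_2)
    (a b c a' c' : 'I_m) :
  convex_position p ->
  abscissa (p a) < abscissa (p b) < abscissa (p c) ->
  abscissa (p a') < abscissa (p b) < abscissa (p c') ->
  0 <= orientation (p a) (p c) (p b) ->
  orientation (p a') (p c') (p b) <= 0 ->
  orientation (p a') (p c') (p b) < orientation (p a) (p c) (p b) -> False.
Proof.
move=> cvx.
have ne (l k : 'I_m) : abscissa (p l) < abscissa (p k) -> (k == l) = false.
  by move=> lt; apply/eqP => e; rewrite e ltxx in lt.
move=> /andP[ab bc] /andP[a'b bc'].
move: (ne _ _ ab) (ne _ _ a'b) (ne _ _ bc) (ne _ _ bc').
rewrite ![_ == b]eq_sym => ba ba' cb cb'.
move: ab bc a'b bc'; rewrite /orientation.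
set xa := abscissa (p a); set xb := abscissa (p b); set xc := abscissa (p c).
set xa' := abscissa (p a'); set xc' := abscissa (p c').
set ya := ordinate (p a); set yb := ordinate (p b); set yc := ordinate (p c).
set ya' := ordinate (p a'); set yc' := ordinate (p c').
move=> ab bc a'b bc' o1 o2 o12.
(* These weights put the abscissa of [b] on the segments [ac] and [a'c']; [yq] and [yr] are the
   ordinates reached there, with [yq <= yb <= yr]. *)
pose s := (xc - xb) / (xc - xa); pose s' := (xc' - xb) / (xc' - xa').
pose yq := s * ya + (1 - s) * yc; pose yr := s' * ya' + (1 - s') * yc'.
have ac0 : 0 < xc - xa by lra.
have ac0' : 0 < xc' - xa' by lra.
have s01 : 0 <= s <= 1.
  by rewrite /s ler_pdivrMr // divr_ge0 ?ltW //=; lra.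
have s01' : 0 <= s' <= 1.
  by rewrite /s' ler_pdivrMr // divr_ge0 ?ltW //=; lra.
have Eq : yb - yq = ((xc - xa) * (yb - ya) - (yc - ya) * (xb - xa)) / (xc - xa).
  by rewrite /yq /s; field; rewrite gt_eqF.
have Er : yb - yr =
    ((xc' - xa') * (yb - ya') - (yc' - ya') * (xb - xa')) / (xc' - xa').
  by rewrite /yr /s'; field; rewrite gt_eqF.
have qb : 0 <= yb - yq by rewrite Eq divr_ge0 // ltW.
have br : yb - yr <= 0 by rewrite Er pmulr_lle0 ?invr_gt0.
(* The strict hypothesis keeps the two crossing points apart, which allows the division defining
   [t]. *)
have qr : 0 < yr - yq.
  have [o1_gt0|o1_le0] := ltP 0 ((xc - xa) * (yb - ya) - (yc - ya) * (xb - xa)).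
    by have : 0 < yb - yq; [rewrite Eq divr_gt0 | lra].
  have : yb - yr < 0; last by lra.
  by rewrite Er pmulr_llt0 ?invr_gt0 //; lra.
pose t := (yr - yb) / (yr - yq).
have t01 : 0 <= t <= 1.
  rewrite /t ler_pdivrMr // mul1r lerD2l lerN2 -subr_ge0 qb andbT.
  by rewrite divr_ge0 ?(ltW qr) // -oppr_le0 opprB.
(* The four endpoints may coincide, so their weights are accumulated through indicators instead of
   being assigned by cases. *)
pose w (l : 'I_m) := t * s * (l == a)%:R + t * (1 - s) * (l == c)%:R
  + (1 - t) * s' * (l == a')%:R + (1 - t) * (1 - s') * (l == c')%:R.
have sumw F : \sum_(l < m) w l * F l = t * (s * F a + (1 - s) * F c)
    + (1 - t) * (s' * F a' + (1 - s') * F c').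
  transitivity (t * s * F a + t * (1 - s) * F c
    + (1 - t) * s' * F a' + (1 - t) * (1 - s') * F c'); last by ring.
  rewrite -(sum_delta a) -(sum_delta c) -(sum_delta a') -(sum_delta c').
  rewrite !mulr_sumr -!big_split /=; apply: eq_bigr => l _.
  by rewrite /w; ring.
apply: (cvx b w).
- move=> l; case/andP: t01 => t0 t1; case/andP: s01 => s0 s1.
  case/andP: s01' => s0' s1'.
  rewrite -subr_ge0 in t1; rewrite -subr_ge0 in s1; rewrite -subr_ge0 in s1'.
  have nn (x y : R) (e : bool) : 0 <= x -> 0 <= y -> 0 <= x * y * e%:R.
    by move=> x0 y0; rewrite !mulr_ge0.
  by rewrite /w !addr_ge0 // nn.
- by rewrite /w ba ba' cb cb' /=; ring.
- by under eq_bigr do rewrite -[w _]mulr1; rewrite sumw; ring.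
have X : xb = \sum_(l < m) w l * abscissa (p l).
  rewrite sumw -/xa -/xc -/xa' -/xc'.
  have -> : s * xa + (1 - s) * xc = xb by rewrite /s; field; rewrite gt_eqF.
  have -> : s' * xa' + (1 - s') * xc' = xb by rewrite /s'; field; rewrite gt_eqF.
  by ring.
have Y : yb = \sum_(l < m) w l * ordinate (p l).
  rewrite sumw -/ya -/yc -/ya' -/yc' -/yq -/yr /t.
  by field; rewrite gt_eqF.
apply/rowP => i; rewrite summxE.
have [->|->] : i = 0 \/ i = 1 by case: i => -[|[]//] ?; [left|right]; exact: val_inj.
- by rewrite -/(abscissa (p b)) -/xb X; apply: eq_bigr => l _; rewrite mxE.
- by rewrite -/(ordinate (p b)) -/yb Y; apply: eq_bigr => l _; rewrite mxE.
Qed.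

(** The orientation is minus the sum of the heights of [a] and [c] over [b], weighted by positive
    horizontal gaps. *)
Lemma orientation_below (R : realType) (h : R) (a b c : 'rV[R]_2) :
  abscissa a < abscissa b < abscissa c ->
  h < ordinate a -> h < ordinate c -> ordinate b < h -> orientation a c b < 0.
Proof.
move=> /andP[ab bc] ha hc hb.
have -> : orientation a c b =
    - ((abscissa c - abscissa b) * (ordinate a - ordinate b)
       + (abscissa b - abscissa a) * (ordinate c - ordinate b)).
  by rewrite /orientation; ring.
by rewrite oppr_lt0 addr_gt0 // mulr_gt0 //; lra.
Qed.

Lemma orientation_above (R : realType) (h : R) (a b c : 'rV[R]_2) :
  abscissa a < abscissa b < abscissa c ->
  ordinate a < h -> ordinate c < h -> h < ordinate b -> 0 < orientation a c b.
Proof.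
move=> /andP[ab bc] ha hc hb.
have -> : orientation a c b =
    (abscissa c - abscissa b) * (ordinate b - ordinate a)
       + (abscissa b - abscissa a) * (ordinate b - ordinate c).
  by rewrite /orientation; ring.
by rewrite addr_gt0 // mulr_gt0 //; lra.
Qed.

(** * Signs of the vertices and their position relative to diagonals *)

Definition upper (sigma : seq bool) (k : nat) : bool :=
  nth false (extended_signs sigma) k.

Lemma upper1 (sigma : seq bool) : upper sigma 1 = false. Proof. by []. Qed.

Lemma upper_penultimate (n : nat) (sigma : (n.-1).-tuple bool) :
  (1 <= n)%N -> upper sigma n.+1 = false.
Proof.
case: n sigma => // n sigma _.
by rewrite /upper /extended_signs /= nth_cat size_tuple ltnn subnn.
Qed.

Lemma upper_last (n : nat) (sigma : (n.-1).-tuple bool) :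
  (1 <= n)%N -> upper sigma n.+2.
Proof.
case: n sigma => // n sigma _.
by rewrite /upper /extended_signs /= nth_cat size_tuple ltnNge leqnSn subSnn.
Qed.

(** An upper [b] is strictly above the line joining the vertices 1 and n + 1, both lower; were it on
    or below [ac], [convex_position_between] would contradict convexity. A lower [b] is compared in
    the same way with the line joining 0 and n + 2, both upper. This is what the four prescribed
    signs are for. *)
Lemma orientation_between (R : realType) (n : nat) (sigma : (n.-1).-tuple bool)
    (p : 'I_n.+3 -> 'rV[R]_2) (a b c : 'I_n.+3) :
  (1 <= n)%N -> is_polygon sigma p -> (a < b < c)%N ->
  (orientation (p a) (p c) (p b) < 0) = ~~ upper sigma b /\
  (0 < orientation (p a) (p c) (p b)) = upper sigma b.
Proof.
move=> n1 [cvx mono [h hp]] /andP[ab bc].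
have hu (k : 'I_n.+3) : upper sigma k -> h < ordinate (p k).
  by move=> uk; have := hp k; rewrite -/(upper _ _) uk.
have hd (k : 'I_n.+3) : upper sigma k = false -> ordinate (p k) < h.
  by move=> uk; have := hp k; rewrite -/(upper _ _) uk.
have abc : abscissa (p a) < abscissa (p b) < abscissa (p c) by rewrite !mono.
have upn1 := upper_penultimate sigma n1.
have cn : (c <= n.+2)%N by rewrite -ltnS.
case ub : (upper sigma b).
- suff o : 0 < orientation (p a) (p c) (p b) by rewrite o [_ < 0]lt_gtF.
  rewrite ltNge; apply/negP => o.
  (* An upper vertex between two others is neither 1 nor n + 1, hence lies strictly between
     these. *)
  have b1 : (1 < b)%N.
    rewrite ltn_neqAle (leq_ltn_trans _ ab) // andbT.
    by apply/eqP => b1; rewrite -b1 upper1 in ub.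
  have bn : (b < n.+1)%N.
    rewrite ltn_neqAle -ltnS (leq_trans bc) // andbT.
    by apply/eqP => bn; rewrite bn upn1 in ub.
  have xb : abscissa (p (inord 1)) < abscissa (p b) < abscissa (p (inord n.+1)).
    by rewrite !mono ?inordK.
  have o' : 0 < orientation (p (inord 1)) (p (inord n.+1)) (p b).
    by apply: (orientation_above (h := h)) => //;
       [apply: hd | apply: hd | exact: hu]; rewrite inordK.
  by apply: (convex_position_between cvx xb abc (ltW o') o); exact: le_lt_trans o'.
- suff o : orientation (p a) (p c) (p b) < 0 by rewrite o [0 < _]lt_gtF.
  rewrite ltNge; apply/negP => o.
  have xb : abscissa (p ord0) < abscissa (p b) < abscissa (p ord_max).
    by rewrite !mono //= ?(leq_trans bc) // (leq_ltn_trans _ ab).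
  have o' : orientation (p ord0) (p ord_max) (p b) < 0.
    apply: (orientation_below (h := h)) => //; [exact: hu | | exact: hd].
    by apply: hu; rewrite /= upper_last.
  by apply: (convex_position_between cvx abc xb o (ltW o')); exact: lt_le_trans o.
Qed.

(** The middle one of the three vertices decides: exchanging two of them reverses the orientation,
    so a vertex to the left of [i] is below [ij] exactly when [i] is above the line from that vertex
    to [j]. *)
Lemma mem_vertices_below (R : realType) (n : nat) (sigma : (n.-1).-tuple bool)
    (p : 'I_n.+3 -> 'rV[R]_2) (i j k : 'I_n.+3) :
  (1 <= n)%N -> is_polygon sigma p -> (i < j)%N ->
  (k \in vertices_below p i j) =
  [|| (i < k < j)%N && ~~ upper sigma k, (k < i)%N && upper sigma i
    | (j < k)%N && upper sigma j].
Proof.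
move=> n1 hp ij; rewrite inE.
have sgn a b c := orientation_between (a := a) (b := b) (c := c) n1 hp.
case: (ltngtP k i) => ki /=; last 1 first.
- by rewrite (val_inj ki) orientation_id1 ltxx ltnNge (ltnW ij).
- have [|_ <-] := sgn k i j; first by rewrite ki.
  by rewrite orientation_swap13 oppr_lt0 [(j < k)%N]ltnNge (ltnW (ltn_trans ki ij)) orbF.
case: (ltngtP k j) => kj /=; last 1 first.
- by rewrite (val_inj kj) orientation_id2 ltxx.
- by have [|-> _] := sgn i k j; rewrite ?ki ?kj ?orbF.
have [|_ <-] := sgn i j k; first by rewrite ij kj.
by rewrite orientation_swap23 oppr_lt0.
Qed.

Lemma mem_vertices_above (R : realType) (n : nat) (sigma : (n.-1).-tuple bool)
    (p : 'I_n.+3 -> 'rV[R]_2) (i j k : 'I_n.+3) :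
  (1 <= n)%N -> is_polygon sigma p -> (i < j)%N ->
  (k \in vertices_above p i j) =
  [|| (i < k < j)%N && upper sigma k, (k < i)%N && ~~ upper sigma i
    | (j < k)%N && ~~ upper sigma j].
Proof.
move=> n1 hp ij; rewrite inE.
have sgn a b c := orientation_between (a := a) (b := b) (c := c) n1 hp.
case: (ltngtP k i) => ki /=; last 1 first.
- by rewrite (val_inj ki) orientation_id1 ltxx ltnNge (ltnW ij).
- have [|<- _] := sgn k i j; first by rewrite ki.
  by rewrite orientation_swap13 oppr_gt0 [(j < k)%N]ltnNge (ltnW (ltn_trans ki ij)) orbF.
case: (ltngtP k j) => kj /=; last 1 first.
- by rewrite (val_inj kj) orientation_id2 ltxx.
- by have [|_ ->] := sgn i k j; rewrite ?ki ?kj ?orbF.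
have [|<- _] := sgn i j k; first by rewrite ij kj.
by rewrite orientation_swap23 oppr_gt0.
Qed.

(* With [u j] for "j lies on the upper chain", these are the sets of coordinates
   cut out by the diagonals: a coordinate between two others follows them
   whenever both take the value [~~ u j].  The signs of the two extreme
   coordinates are irrelevant. *)
Definition admissible (n : nat) (u : 'I_n.+1 -> bool) : {set {set 'I_n.+1}} :=
  [set S : {set 'I_n.+1} | [&& S != finset.set0, S != [set: 'I_n.+1]%SET &
    [forall i : 'I_n.+1, forall j : 'I_n.+1, forall k : 'I_n.+1,
      [&& (i < j < k)%N, (i \in S) == ~~ u j & (k \in S) == ~~ u j]
        ==> ((j \in S) == ~~ u j)]]].

Lemma admissibleP (n : nat) (u : 'I_n.+1 -> bool) (S : {set 'I_n.+1}) :
  reflect [/\ exists k, k \in S, exists k, k \notin S &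
    forall i j k : 'I_n.+1, (i < j < k)%N ->
      (i \in S) = ~~ u j -> (k \in S) = ~~ u j -> (j \in S) = ~~ u j]
    (S \in admissible u).
Proof.
have TP : (exists k, k \notin S) <-> S != [set: 'I_n.+1]%SET.
  rewrite -finset.subTset; split=> [[k kS]|/fintype.subsetPn[k _ kS]]; last by exists k.
  by apply/fintype.subsetPn; exists k.
have SP : (exists k, k \in S) <-> S != finset.set0.
  by split=> [[k kS]|/finset.set0Pn//]; apply/finset.set0Pn; exists k.
rewrite inE; apply: (iffP and3P) => -[/SP ? /TP ? H]; split=> //.
  move=> i j k ijk iS kS; move/forallP/(_ i)/forallP/(_ j)/forallP/(_ k): H.
  by rewrite ijk iS kS eqxx => /eqP.
apply/forallP => i; apply/forallP => j; apply/forallP => k.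
by apply/implyP => /and3P[ijk /eqP iS /eqP kS]; apply/eqP; apply: H ijk iS kS.
Qed.

(** For the family of all nonempty proper subsets this is the permutahedron; a smaller family keeps
    only some of its inequalities. *)
Definition cut_polytope (R : realType) (n : nat) (Fam : {set {set 'I_n.+1}}) :
    set 'rV[R]_n.+1 :=
  [set x : 'rV[R]_n.+1 |
    (forall S, S \in Fam ->
       2^-1 * #|S|%:R * (#|S|%:R + 1) <= \sum_(k in S) x 0 k) /\
    \sum_(k < n.+1) x 0 k = n.+1%:R * n.+2%:R / 2].
Arguments cut_polytope R {n} Fam.

Definition cut_coords (R : realType) (n : nat) (p : 'I_n.+3 -> 'rV[R]_2)
    (i j : 'I_n.+3) : {set 'I_n.+1} :=
  [set k | coord_label k \in S_set p i j].

Lemma val_coord_label (n : nat) (k : 'I_n.+1) : coord_label k = k.+1 :> nat.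
Proof. by rewrite inordK // !ltnS ltnW // ltn_ord. Qed.

(** Vertex 0 is below [ij] exactly when [i] is upper and positive, and replacing it adds [i] to the
    vertices on its left; n + 2 and [j] behave symmetrically. The endpoints are thus included:
    coordinate [k] has label k + 1, and [k < i] says that this label is at most [i]. *)
Lemma mem_cut_coords (R : realType) (n : nat) (sigma : (n.-1).-tuple bool)
    (p : 'I_n.+3 -> 'rV[R]_2) (i j : 'I_n.+3) (k : 'I_n.+1) :
  (1 <= n)%N -> is_polygon sigma p -> (i < j)%N ->
  (k \in cut_coords p i j) =
  [|| (i < k.+1 < j)%N && ~~ upper sigma k.+1, (k < i)%N && upper sigma i
    | (j <= k.+1)%N && upper sigma j].
Proof.
have ifE (b c : bool) : (if b then c else false) = b && c by [].
move=> n1 hp ij; rewrite inE /S_set !finset.in_setU !finset.in_setD1.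
rewrite !(mem_vertices_below _ n1 hp ij) /= val_coord_label.
have jn : (j <= n.+2)%N by rewrite -ltnS.
have kn : (k < n.+1)%N by [].
have -> : coord_label k != ord_max.
  by rewrite -val_eqE /= val_coord_label eqSS neq_ltn kn.
have -> : coord_label k != ord0 by rewrite -val_eqE /= val_coord_label.
rewrite !(fun_if (fun A : {set 'I_n.+3} => coord_label k \in A)) !inE.
rewrite -!val_eqE /= val_coord_label ?ltn0 /=.
have -> : (i < n.+2 < j)%N = false by lia.
have -> : (n.+2 < i)%N = false by lia.
rewrite /= !orbF !ifE.
case: (upper sigma i); case: (upper sigma j); rewrite ?andbT ?andbF ?orbF /=;
  case: (upper sigma k.+1); rewrite ?andbT ?andbF ?orbF /=; lia.
Qed.

(** Neither 0 nor n + 2 survives in [S_set], so each of its elements is the label of a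
    coordinate. *)
Lemma card_cut_coords (R : realType) (n : nat) (sigma : (n.-1).-tuple bool)
    (p : 'I_n.+3 -> 'rV[R]_2) (i j : 'I_n.+3) :
  (1 <= n)%N -> is_polygon sigma p -> (i < j)%N ->
  #|cut_coords p i j| = #|S_set p i j|.
Proof.
move=> n1 hp ij; have inj : injective (@coord_label n).
  by move=> k l /(congr1 val); rewrite /= !val_coord_label => -[] /val_inj.
rewrite -(card_imset _ inj); apply: eq_card => q.
apply/imsetP/idP => [[k]|qS]; first by rewrite inE => kS ->.
have ifE (b c : bool) : (if b then c else false) = b && c by [].
have q0n : (0 < q < n.+2)%N.
  have jn : (j <= n.+2)%N by rewrite -ltnS.
  move: qS; rewrite /S_set !finset.in_setU !finset.in_setD1.
  rewrite !(mem_vertices_below _ n1 hp ij) /=.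
  rewrite !(fun_if (fun A : {set 'I_n.+3} => q \in A)) !inE -!val_eqE /= ?ltn0 /=.
  have -> : (i < n.+2 < j)%N = false by lia.
  have -> : (n.+2 < i)%N = false by lia.
  rewrite /= !orbF !ifE; have := ltn_ord q.
  case: (upper sigma i); case: (upper sigma j); rewrite ?andbT ?andbF ?orbF /=;
    case: (upper sigma q); rewrite ?andbT ?andbF ?orbF /=; lia.
have qE : q = coord_label (inord q.-1 : 'I_n.+1).
  by apply: val_inj; rewrite /= val_coord_label inordK; lia.
by exists (inord q.-1); rewrite // inE -qE.
Qed.

Definition coord_sign (n : nat) (sigma : seq bool) (k : 'I_n.+1) : bool :=
  upper sigma k.+1.
Arguments coord_sign {n}.

Lemma coord_label_onto (n : nat) (q : 'I_n.+3) :
  (0 < q < n.+2)%N -> exists k : 'I_n.+1, q = k.+1 :> nat.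
Proof. by move=> qn; exists (inord q.-1); rewrite inordK; lia. Qed.

(** A vertex below [ij] and to the left of [i] shows that [i] is upper and carries a coordinate,
    which belongs to the cut; the right side is symmetric, and vertices above yield coordinates
    outside the cut. The remaining condition is a case analysis on signs. *)
Lemma diagonal_admissible (R : realType) (n : nat) (sigma : (n.-1).-tuple bool)
    (p : 'I_n.+3 -> 'rV[R]_2) (i j : 'I_n.+3) :
  (1 <= n)%N -> is_polygon sigma p -> diagonal p i j ->
  cut_coords p i j \in admissible (coord_sign sigma).
Proof.
move=> n1 hp /and3P[ij /finset.set0Pn[b bB] /finset.set0Pn[a aA]].
have mem k := mem_cut_coords k n1 hp ij.
have jn : (j <= n.+2)%N by rewrite -ltnS.
apply/admissibleP; split.
- move: bB; rewrite (mem_vertices_below _ n1 hp ij).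
  case/or3P => /andP[bij ub].
  + have [|k kb] := @coord_label_onto n b; first by lia.
    by exists k; rewrite mem -kb bij ub.
  + have [|k ki] := @coord_label_onto n i; first by lia.
    by exists k; rewrite mem ub ki ltnSn orbT.
  + have [|k kj] := @coord_label_onto n j; first by have := ltn_ord b; lia.
    by exists k; rewrite mem ub kj leqnn !orbT.
- move: aA; rewrite (mem_vertices_above _ n1 hp ij).
  case/or3P => /andP[aij ua].
  + have [|k ka] := @coord_label_onto n a; first by lia.
    by exists k; rewrite mem -ka ua; case: (upper _ i); case: (upper _ j); lia.
  + have [|k ki] := @coord_label_onto n i; first by lia.
    by exists k; rewrite mem -ki (negbTE ua); case: (upper _ j); lia.
  + have [|k kj] := @coord_label_onto n j; first by have := ltn_ord a; lia.
    by exists k; rewrite mem -kj (negbTE ua); case: (upper _ i); lia.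
move=> x y z xyz; rewrite !mem /coord_sign.
by case: (upper _ i); case: (upper _ j); case: (upper _ y.+1);
  case: (upper _ x.+1); case: (upper _ z.+1); lia.
Qed.

(** Let [i] be maximal such that all labels up to [i] share one membership, equal to the sign of
    [i], and [j] minimal for the mirrored condition. A coordinate strictly between them whose
    membership equals its sign would, by extremality, have coordinates of the other membership on
    both sides, against admissibility. *)
Lemma admissible_diagonal (R : realType) (n : nat) (sigma : (n.-1).-tuple bool)
    (p : 'I_n.+3 -> 'rV[R]_2) (S : {set 'I_n.+1}) :
  (1 <= n)%N -> is_polygon sigma p -> S \in admissible (coord_sign sigma) ->
  exists i j, diagonal p i j /\ cut_coords p i j = S.
Proof.
move=> n1 hp /admissibleP[[k1 k1S] [k0 k0S] H].
pose PI (i : 'I_n.+3) := [&& (i < n.+2)%N, upper sigma i == (ord0 \in S)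
  & [forall k : 'I_n.+1, (k < i)%N ==> ((k \in S) == (ord0 \in S))]].
pose PJ (j : 'I_n.+3) := [&& (0 < j)%N, upper sigma j == (ord_max \in S)
  & [forall k : 'I_n.+1, (j <= k.+1)%N ==> ((k \in S) == (ord_max \in S))]].
have un1 := upper_penultimate sigma n1; have un2 := upper_last sigma n1.
(* Since 0 is upper and 1 is lower, one of the two carries the membership of the first coordinate; n
   + 2 and n + 1 do the same at the right end. *)
have PI0 : PI (if ord0 \in S then ord0 else inord 1).
  rewrite /PI; case: ifP => S0; rewrite ?inordK //=; apply/forallP => k //.
  apply/implyP => k_lt; rewrite -S0; apply/eqP; congr (_ \in S).
  by apply: val_inj => /=; lia.
have PJ0 : PJ (if ord_max \in S then ord_max else inord n.+1).
  rewrite /PJ; case: ifP => Sn; rewrite ?inordK //= ?un1 ?un2 /=.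
    by apply/forallP => k; have := ltn_ord k; lia.
  apply/forallP => k; apply/implyP => kn; rewrite -Sn; apply/eqP; congr (_ \in S).
  by apply: val_inj => /=; have := ltn_ord k; lia.
have [i /and3P[i_lt /eqP ui /forallP Hi] imax] := arg_maxnP (@nat_of_ord _) PI0.
have [j /and3P[j_gt /eqP uj /forallP Hj] jmin] := arg_minnP (@nat_of_ord _) PJ0.
have {}Hi (k : 'I_n.+1) : (k < i)%N -> (k \in S) = (ord0 \in S).
  by move=> ki; apply/eqP; move: (Hi k); rewrite ki.
have {}Hj (k : 'I_n.+1) : (j <= k.+1)%N -> (k \in S) = (ord_max \in S).
  by move=> jk; apply/eqP; move: (Hj k); rewrite jk.
(* If the two constant stretches met, [S] would be empty or full. *)
have ij : (i < j)%N.
  rewrite ltnNge; apply/negP => ji.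
  have S0n : (ord0 \in S) = (ord_max \in S).
    have i1 : (i.-1.+1 = i)%N by rewrite prednK // (leq_trans j_gt ji).
    have qE : (inord i.-1 : 'I_n.+1) = i.-1 :> nat by rewrite inordK // i1.
    by rewrite -(Hi (inord i.-1)) ?(Hj (inord i.-1)) // qE i1.
  have const (k : 'I_n.+1) : (k \in S) = (ord0 \in S).
    have [ki|ik] := ltnP k i; first exact: Hi.
    by rewrite S0n; apply: Hj; rewrite (leq_trans ji) // ltnW.
  by move: k0S; rewrite const -(const k1) k1S.
have Hij (k : 'I_n.+1) : (i < k.+1 < j)%N -> (k \in S) = ~~ upper sigma k.+1.
  move=> /andP[ik kj]; set v := upper sigma k.+1.
  have [//|kv] := boolP ((k \in S) == ~~ v); first by move/eqP.
  have {}kv : (k \in S) = v by move: kv; case: (k \in S); case: v.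
  have [/forallP low|] := boolP [forall x : 'I_n.+1, (x <= k)%N ==> ((x \in S) == v)].
    have v0 : (ord0 \in S) = v by apply/eqP; have := low ord0.
    suff /imax : PI (coord_label k) by rewrite /= val_coord_label leqNgt ik.
    rewrite /PI val_coord_label v0 eqxx /= ltnS ltn_ord /=.
    by apply/forallP => x; rewrite ltnS; exact: low.
  rewrite negb_forall => /existsP[x]; rewrite negb_imply => /andP[xk xv].
  have [/forallP high|] := boolP [forall x : 'I_n.+1, (k <= x)%N ==> ((x \in S) == v)].
    have vn : (ord_max \in S) = v.
      by apply/eqP; have := high ord_max; rewrite /= -ltnS ltn_ord.
    suff /jmin : PJ (coord_label k) by rewrite /= val_coord_label leqNgt kj.
    rewrite /PJ val_coord_label vn eqxx /=.
    by apply/forallP => y; rewrite ltnS; exact: high.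
  rewrite negb_forall => /existsP[y]; rewrite negb_imply => /andP[ky yv].
  have xk' : x != k by apply: contraNneq xv => ->; rewrite kv.
  have yk' : y != k by apply: contraNneq yv => ->; rewrite kv.
  apply: (H x k y).
  - by rewrite !ltn_neqAle xk ky !andbT -!val_eqE /= in xk' yk' *; rewrite xk' eq_sym.
  - by move: xv; case: (x \in S); rewrite /coord_sign -/v; case: (v).
  - by move: yv; case: (y \in S); rewrite /coord_sign -/v; case: (v).
have mem (k : 'I_n.+1) : (k \in cut_coords p i j) = (k \in S).
  rewrite (mem_cut_coords k n1 hp ij).
  have [ki|ik] := ltnP k i.
    by rewrite Hi // ui ltnS leqNgt ki /= [(j <= _)%N]leqNgt (leq_ltn_trans ki ij) orbF.
  have [jk|kj] := leqP j k.+1.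
    by rewrite Hj // uj andbF.
  by rewrite Hij ?ltnS ?ik //=; case: (upper _ k.+1).
exists i, j; split; last by apply/setP.
rewrite /diagonal ij /=; apply/andP; split; apply/finset.set0Pn.
- move: k1S; rewrite -mem (mem_cut_coords k1 n1 hp ij) => /or3P[] /andP[k1ij u1].
  + exists (coord_label k1).
    by rewrite (mem_vertices_below _ n1 hp ij) val_coord_label k1ij u1.
  + exists ord0; rewrite (mem_vertices_below _ n1 hp ij) u1 /=.
    by rewrite (leq_ltn_trans _ k1ij) ?orbT.
  + exists ord_max; rewrite (mem_vertices_below _ n1 hp ij) u1 /= andbT.
    by rewrite (leq_ltn_trans k1ij) ?orbT // ltnS ltn_ord.
- have [k0i|ik0] := ltnP k0 i.
    exists ord0; rewrite (mem_vertices_above _ n1 hp ij) ui -(Hi k0) // k0S /=.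
    by rewrite (leq_ltn_trans _ k0i) ?orbT.
  have [jk0|k0j] := leqP j k0.+1.
    exists ord_max; rewrite (mem_vertices_above _ n1 hp ij) uj -(Hj k0) // k0S /= andbT.
    by rewrite (leq_ltn_trans jk0) ?orbT // ltnS ltn_ord.
  exists (coord_label k0); rewrite (mem_vertices_above _ n1 hp ij) val_coord_label.
  by rewrite ltnS ik0 k0j /= -[upper _ _]negbK -Hij ?k0S // ltnS ik0.
Qed.

(** From here on the polygon disappears and only the signs of the coordinates remain. *)
Lemma AssI_cut_polytope (R : realType) (n : nat) (sigma : (n.-1).-tuple bool)
    (p : 'I_n.+3 -> 'rV[R]_2) :
  (1 <= n)%N -> is_polygon sigma p ->
  AssI p = cut_polytope R (admissible (coord_sign sigma)).
Proof.
move=> n1 hp.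
have sumE (i j : 'I_n.+3) (x : 'rV[R]_n.+1) :
    \sum_(k < n.+1 | coord_label k \in S_set p i j) x 0 k
    = \sum_(k in cut_coords p i j) x 0 k.
  by apply: eq_bigl => k; rewrite [RHS]inE.
apply/seteqP; split=> x [Hx xsum]; split=> //.
  move=> S /(admissible_diagonal n1 hp)[i [j [ij <-]]].
  by rewrite -sumE (card_cut_coords n1 hp) ?Hx //; case/and3P: ij.
move=> i j ij; rewrite sumE -(card_cut_coords n1 hp); last by case/and3P: ij.
exact: Hx (diagonal_admissible n1 hp ij).
Qed.

(** * The number of admissible sets *)

(* The cut along the line through the coordinates [a] and [b], slightly rotated
   so as to separate them whenever they lie on the same chain.  The pairs
   [a <= b] other than the two extreme coordinates parametrize the admissible
   sets, whose number is hence independent of the signs. *)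
Definition rotated_cut (n : nat) (u : 'I_n.+1 -> bool) (ab : 'I_n.+1 * 'I_n.+1) :
    {set 'I_n.+1} :=
  [set q : 'I_n.+1 | if (q < ab.1)%N then u ab.1 else if (ab.2 < q)%N then u ab.2
           else if q == ab.1 then ~~ u ab.2 else if q == ab.2 then ~~ u ab.1
           else ~~ u q].

Definition cut_index (n : nat) : {set 'I_n.+1 * 'I_n.+1} :=
  [set ab : 'I_n.+1 * 'I_n.+1 |
    (ab.1 <= ab.2)%N && ~~ ((ab.1 == ord0) && (ab.2 == ord_max))].

Lemma rotated_cut_lt (n : nat) (u : 'I_n.+1 -> bool) (a b q : 'I_n.+1) :
  (q < a)%N -> (q \in rotated_cut u (a, b)) = u a.
Proof. by move=> qa; rewrite inE /= qa. Qed.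

Lemma rotated_cut_gt (n : nat) (u : 'I_n.+1 -> bool) (a b q : 'I_n.+1) :
  (a <= b)%N -> (b < q)%N -> (q \in rotated_cut u (a, b)) = u b.
Proof. by move=> ab bq; rewrite inE /= bq ltnNge ltnW ?(leq_ltn_trans ab bq). Qed.

Lemma rotated_cut_left (n : nat) (u : 'I_n.+1 -> bool) (a b : 'I_n.+1) :
  (a <= b)%N -> (a \in rotated_cut u (a, b)) = ~~ u b.
Proof. by move=> ab; rewrite inE /= ltnn ltnNge ab eqxx. Qed.

Lemma rotated_cut_right (n : nat) (u : 'I_n.+1 -> bool) (a b : 'I_n.+1) :
  (a <= b)%N -> (b \in rotated_cut u (a, b)) = ~~ u a.
Proof. by move=> ab; rewrite inE /= ltnn ltnNge ab eqxx /=; case: eqP => [->|]. Qed.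

Lemma rotated_cut_between (n : nat) (u : 'I_n.+1 -> bool) (a b q : 'I_n.+1) :
  (a < q < b)%N -> (q \in rotated_cut u (a, b)) = ~~ u q.
Proof.
move=> /andP[aq qb]; rewrite inE /= !ltnNge (ltnW aq) (ltnW qb) /=.
by rewrite -!val_eqE /= gtn_eqF // ltn_eqF.
Qed.

Lemma upper_gt0 (n : nat) (u : 'I_n.+1 -> bool) :
  u ord0 = false -> forall c, u c -> (0 < c)%N.
Proof.
move=> u0 c uc; rewrite lt0n; apply: contraTneq uc => c0.
by rewrite (_ : c = ord0) ?u0 //; exact: val_inj.
Qed.

(** Membership is constant to the left of [a] and to the right of [b], and opposite to the sign
    strictly between, so the condition holds there at once; at [a] and at [b] its premises are
    contradictory. *)
Lemma rotated_cut_admissible (n : nat) (u : 'I_n.+1 -> bool)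
    (ab : 'I_n.+1 * 'I_n.+1) :
  u ord0 = false -> u ord_max = false -> ab \in cut_index n ->
  rotated_cut u ab \in admissible u.
Proof.
case: ab => a b u0 un; rewrite inE /= => /andP[ab abn].
have pos := upper_gt0 u0.
apply/admissibleP; split.
- case ua: (u a).
    by exists ord0; rewrite rotated_cut_lt // pos.
  by exists b; rewrite rotated_cut_right // ua.
- case ub: (u b); first by exists a; rewrite rotated_cut_left // ub.
  case ua: (u a); first by exists b; rewrite rotated_cut_right // ua.
  have [a0|a0] := eqVneq a ord0; last first.
    by exists ord0; rewrite rotated_cut_lt ?ua // lt0n.
  exists ord_max; rewrite rotated_cut_gt ?ub //.
  by rewrite a0 eqxx /= in abn; rewrite ltn_neqAle abn -ltnS ltn_ord.
move=> x y z /andP[xy yz].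
have [ya|ya|/val_inj ya] := ltngtP y a.
- by rewrite (rotated_cut_lt u b ya) (rotated_cut_lt u b (ltn_trans xy ya)).
- have [yb|yb|/val_inj yb] := ltngtP y b.
  + by move=> _ _; rewrite rotated_cut_between ?ya.
  + by rewrite (rotated_cut_gt u ab yb) (rotated_cut_gt u ab (ltn_trans yb yz)).
  + by subst y; rewrite (rotated_cut_gt u ab yz) => _; case: (u b).
- by subst y; rewrite (rotated_cut_lt u b xy); case: (u a).
Qed.

(** If [a < a'], the memberships of [a], [b] and [b'] force [u a = u b] and [u a' = u b'], with
    opposite values. The first coordinate then gives [a = ord0], so that [b] is not last, and the
    last coordinate gives a contradiction. The pair excluded from [cut_index] would yield the set of
    all lower coordinates, which is either everything or the cut of the first and last upper
    ones. *)
Lemma rotated_cut_inj (n : nat) (u : 'I_n.+1 -> bool) :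
  u ord0 = false -> u ord_max = false ->
  {in cut_index n &, injective (rotated_cut u)}.
Proof.
move=> u0 un.
have sub c : u c -> (c < n)%N.
  move=> uc; rewrite ltn_neqAle -ltnS ltn_ord andbT; apply: contraTneq uc => cn.
  by rewrite (_ : c = ord_max) ?un //; exact: val_inj.
have lt_absurd (a b a' b' : 'I_n.+1) : (a < a')%N -> (a <= b)%N -> (a' <= b')%N ->
    ~~ ((a == ord0) && (b == ord_max)) ->
    rotated_cut u (a, b) = rotated_cut u (a', b') -> False.
  move=> aa' ab ab' abn E.
  have Ea : ~~ u b = u a' by rewrite -(rotated_cut_left u ab) E rotated_cut_lt.
  have same : u a = u b /\ u b' = u a'.
    have [a'b|ba'|/val_inj a'b] := ltngtP a' b; last first.
    - by rewrite a'b in Ea; case: (u b) Ea.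
    - have Eb : ~~ u a = u a' by rewrite -(rotated_cut_right u ab) E rotated_cut_lt.
      have Ea' : u b = ~~ u b'.
        by rewrite -(rotated_cut_left u ab') -E (rotated_cut_gt u ab).
      by move: Ea Eb Ea'; do 4 case: (u _).
    - have Ea' : ~~ u a' = ~~ u b'.
        by rewrite -(rotated_cut_left u ab') -E rotated_cut_between ?aa'.
      have Eb : ~~ u a = if (b < b')%N then ~~ u b else u b'.
        rewrite -(rotated_cut_right u ab) E.
        have [bb'|b'b|/val_inj bb'] := ltngtP b b'.
        + by rewrite rotated_cut_between ?a'b.
        + by rewrite (rotated_cut_gt u ab').
        + by move: Ea Ea'; rewrite bb'; case: (u a'); case: (u b').
      by move: Ea Ea' Eb; case: ifP; do 4 case: (u _).
  case: same => uab uab'.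
  have a0 : a = ord0.
    apply: val_inj; apply/eqP; rewrite /= -leqn0 leqNgt; apply/negP => a_gt0.
    have : u a = u a'.
      by rewrite -(@rotated_cut_lt _ u a b ord0) // E rotated_cut_lt // (ltn_trans a_gt0).
    by rewrite uab -Ea; case: (u b).
  have ub : u b = false by rewrite -uab a0.
  have ub' : u b' by rewrite uab' -Ea ub.
  have bn : (b < n)%N.
    move: abn; rewrite a0 eqxx /= => bn; rewrite ltn_neqAle -ltnS ltn_ord andbT.
    by [].
  have := rotated_cut_gt u ab bn (q := ord_max).
  by rewrite E (rotated_cut_gt u ab') ?sub //= ub ub'.
have right_absurd (a b b' : 'I_n.+1) : (a <= b)%N -> (b < b')%N ->
    rotated_cut u (a, b) = rotated_cut u (a, b') -> False.
  move=> ab bb' E; have ab' := leq_trans ab (ltnW bb').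
  have Eb' : u b = ~~ u a.
    by rewrite -(rotated_cut_right u ab') -E (rotated_cut_gt u ab).
  have [ab_eq|a_neq] := eqVneq a b; first by rewrite ab_eq in Eb'; case: (u b) Eb'.
  have : ~~ u a = ~~ u b.
    rewrite -(rotated_cut_right u ab) E rotated_cut_between //.
    by rewrite bb' andbT ltn_neqAle ab andbT.
  by rewrite Eb'; case: (u a).
move=> [a b] [a' b']; rewrite !inE /= => /andP[ab abn] /andP[ab' abn'] E.
have [aa'|a'a|/val_inj aa'] := ltngtP a a'.
- by case: (lt_absurd a b a' b').
- by case: (lt_absurd a' b' a b).
subst a'; have [bb'|b'b|/val_inj -> //] := ltngtP b b'.
- by case: (right_absurd a b b').
- by case: (right_absurd a b' b).
Qed.

Lemma ord_argmin (n : nat) (P : pred 'I_n) (k : 'I_n) :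
  P k -> exists2 a, P a & forall q, P q -> (a <= q)%N.
Proof. by move=> Pk; case: (arg_minnP (@nat_of_ord _) Pk) => a; exists a. Qed.

Lemma ord_argmax (n : nat) (P : pred 'I_n) (k : 'I_n) :
  P k -> exists2 a, P a & forall q, P q -> (q <= a)%N.
Proof. by move=> Pk; case: (arg_maxnP (@nat_of_ord _) Pk) => a; exists a. Qed.

(** Take for [a] and [b] the first and last coordinates of membership [v]. Between them,
    admissibility gives membership [v] on the chain [~~ v], and the hypothesis excludes it on the
    other chain. *)
Lemma one_chain_rotated_cut (n : nat) (u : 'I_n.+1 -> bool)
    (S : {set 'I_n.+1}) (v : bool) :
  S \in admissible u -> (forall k, (k \in S) = v -> u k = ~~ v) ->
  exists a b : 'I_n.+1, [/\ (a <= b)%N, (a \in S) = v, (b \in S) = v &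
    S = rotated_cut u (a, b)].
Proof.
move=> /admissibleP[[k1 k1S] [k0 k0S] H] Hv.
have [k kv] : exists k, (k \in S) == v.
  by case: (v); [exists k1; rewrite k1S | exists k0; rewrite (negbTE k0S)].
have [a /eqP av amin] := ord_argmin (P := fun q => (q \in S) == v) kv.
have [b /eqP bv bmax] := ord_argmax (P := fun q => (q \in S) == v) kv.
have ab : (a <= b)%N by apply: amin; apply/eqP.
have out (q : 'I_n.+1) : ~~ (a <= q <= b)%N -> (q \in S) = ~~ v.
  move=> qab; have : (q \in S) != v.
    by apply: contra qab => qv; rewrite amin ?bmax.
  by case: (q \in S); case: (v).
exists a, b; split=> //; apply/setP => q.
have [qa|aq|/val_inj ->] := ltngtP q a.
- by rewrite rotated_cut_lt // out ?Hv // leqNgt qa.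
- have [qb|bq|/val_inj ->] := ltngtP q b.
  + rewrite rotated_cut_between ?aq //; have [uq|] := eqVneq (u q) (~~ v).
      by apply: (H a q b); rewrite ?aq // uq negbK.
    have [/Hv -> /eqP //|] := eqVneq (q \in S) v.
    by case: (q \in S); case: (u q); case: (v).
  + by rewrite (rotated_cut_gt u ab) // out ?Hv // [(q <= b)%N]leqNgt bq andbF.
  + by rewrite rotated_cut_right // bv Hv // negbK.
- by rewrite rotated_cut_left // av Hv // negbK.
Qed.

(** Take for [a] the last coordinate whose membership and sign are both [v], and for [b] the first
    one where both are [~~ v]. Admissibility at [a] and [b] makes membership constant outside, while
    extremality makes membership opposite to the sign strictly between. *)
Lemma two_chains_rotated_cut (n : nat) (u : 'I_n.+1 -> bool)
    (S : {set 'I_n.+1}) (v : bool) (l r : 'I_n.+1) :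
  S \in admissible u -> (l < r)%N ->
  (l \in S) = v -> u l = v -> (r \in S) = ~~ v -> u r = ~~ v ->
  exists a b : 'I_n.+1, [/\ (a < b)%N, u a = v, u b = ~~ v & S = rotated_cut u (a, b)].
Proof.
move=> /admissibleP[_ _ H] lr lS ul rS ur.
have lP : ((l \in S) == v) && (u l == v) by rewrite lS ul eqxx.
have [a /andP[/eqP aS /eqP ua] amax] :=
  ord_argmax (P := fun q => ((q \in S) == v) && (u q == v)) lP.
have rP : ((r \in S) == ~~ v) && (u r == ~~ v) by rewrite rS ur eqxx.
have [b /andP[/eqP bS /eqP ub] bmin] :=
  ord_argmin (P := fun q => ((q \in S) == ~~ v) && (u q == ~~ v)) rP.
have la : (l <= a)%N by apply: amax; rewrite lS ul eqxx.
have br : (b <= r)%N by apply: bmin; rewrite rS ur eqxx.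
have neg c d : c <> ~~ d -> c = d :> bool by case: c; case: d.
have after (q : 'I_n.+1) : (r < q)%N -> (q \in S) = ~~ v.
  move=> rq; have [/eqP //|qv] := boolP ((q \in S) == ~~ v).
  have {}qv : (q \in S) = v by apply: neg; apply/eqP.
  by have := H l r q; rewrite lr rq ur negbK lS qv rS => /(_ isT erefl erefl); case: (v).
have ar : (a < r)%N.
  rewrite ltnNge leq_eqVlt; apply/negP => /orP[/eqP/val_inj ra|/after].
    by move: rS; rewrite ra aS; case: (v).
  by rewrite aS; case: (v).
have before (q : 'I_n.+1) : (q < a)%N -> (q \in S) = v.
  move=> qa; have [/eqP //|qv] := boolP ((q \in S) == v).
  have {}qv : (q \in S) = ~~ v by apply: neg; rewrite negbK; apply/eqP.
  by have := H q a r; rewrite qa ar ua aS qv rS => /(_ isT erefl erefl).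
have ab : (a < b)%N.
  rewrite ltnNge leq_eqVlt; apply/negP => /orP[/eqP/val_inj ba|/before].
    by move: bS; rewrite ba aS; case: (v).
  by rewrite bS; case: (v).
have {}after (q : 'I_n.+1) : (b < q)%N -> (q \in S) = ~~ v.
  move=> bq; have [/eqP //|qv] := boolP ((q \in S) == ~~ v).
  have {}qv : (q \in S) = v by apply: neg; apply/eqP.
  by have := H a b q; rewrite ab bq ub negbK aS qv bS => /(_ isT erefl erefl); case: (v).
exists a, b; split=> //; apply/setP => q.
have ab' := ltnW ab.
have [qa|aq|/val_inj ->] := ltngtP q a.
- by rewrite rotated_cut_lt // before.
- have [qb|bq|/val_inj ->] := ltngtP q b.
  + rewrite rotated_cut_between ?aq //; apply: neg => qS.
    have [uq|uq] := eqVneq (u q) v.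
      by have := amax q; rewrite qS negbK uq eqxx leqNgt aq => /(_ isT).
    have {}uq : u q = ~~ v by move: uq; case: (u q); case: (v).
    by have := bmin q; rewrite qS negbK uq eqxx leqNgt qb => /(_ isT).
  + by rewrite (rotated_cut_gt u ab') // after.
  + by rewrite rotated_cut_right // bS ua.
- by rewrite rotated_cut_left // aS ub negbK.
Qed.

(** The cases depend on the coordinates whose membership equals their sign. If none is a lower
    non-member, or none is an upper member, one chain suffices; otherwise one of each kind exists,
    and their order selects the value of [v] for the two chains. *)
Lemma rotated_cut_onto (n : nat) (u : 'I_n.+1 -> bool) (S : {set 'I_n.+1}) :
  u ord0 = false -> u ord_max = false -> S \in admissible u ->
  exists2 ab, ab \in cut_index n & S = rotated_cut u ab.
Proof.
move=> u0 un adm.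
have ends (a b : 'I_n.+1) : u a || u b -> (a, b) \in cut_index n = (a <= b)%N.
  move=> uab; rewrite inE /=.
  suff -> : (a == ord0) && (b == ord_max) = false by rewrite andbT.
  by apply: contraTF uab => /andP[/eqP -> /eqP ->]; rewrite u0 un.
have [/forallP dU|] := boolP [forall k, (k \notin S) ==> u k].
  have [|a [b [ab aS bS ->]]] := @one_chain_rotated_cut n u S false adm.
    by move=> k kS; apply: (implyP (dU k)); rewrite kS.
  exists (a, b) => //; rewrite ends //; apply/orP; left.
  by apply: (implyP (dU a)); rewrite aS.
rewrite negb_forall => /existsP[d]; rewrite negb_imply => /andP[dS ud].
have [/forallP cD|] := boolP [forall k, (k \in S) ==> ~~ u k].
  have [|a [b [ab aS bS SE]]] := @one_chain_rotated_cut n u S true adm.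
    by move=> k kS; apply/negbTE; apply: (implyP (cD k)).
  exists (a, b) => //; rewrite inE /= ab /=; apply/negP => /andP[/eqP a0 /eqP bn].
  have /admissibleP[_ _ H] := adm.
  have d0n : (a < d < b)%N.
    rewrite a0 bn lt0n ltn_neqAle -ltnS ltn_ord andbT; apply/andP; split.
      by apply: contraNneq dS => d0; rewrite (_ : d = a) ?aS // a0; exact: val_inj.
    by apply: contraNneq dS => d0; rewrite (_ : d = b) ?bS // bn; exact: val_inj.
  by have := H _ _ _ d0n; rewrite ud aS bS (negbTE dS) => /(_ erefl erefl).
rewrite negb_forall => /existsP[c]; rewrite negb_imply negbK => /andP[cS uc].
have [cd|dc|cd] := ltngtP c d; last by move: dS; rewrite -(val_inj cd) cS.
- have [a [b [ab ua ub ->]]] :=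
    two_chains_rotated_cut (v := true) adm cd cS uc (negbTE dS) (negbTE ud).
  by exists (a, b); rewrite // ends ?ua // ltnW.
- have [a [b [ab ua ub ->]]] :=
    two_chains_rotated_cut (v := false) adm dc (negbTE dS) (negbTE ud) cS uc.
  by exists (a, b); rewrite // ends ?ub ?orbT // ltnW.
Qed.

(** The common value makes any injection between the admissible families of two sign vectors a
    bijection. *)
Lemma card_admissible (n : nat) (u : 'I_n.+1 -> bool) :
  u ord0 = false -> u ord_max = false -> #|admissible u| = #|cut_index n|.
Proof.
move=> u0 un; rewrite -(card_in_imset (rotated_cut_inj u0 un)).
apply: eq_card => S; apply/idP/imsetP => [/(rotated_cut_onto u0 un)//|[ab abI ->]].
exact: rotated_cut_admissible.
Qed.

(** * The rays of the normal fan *)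

Definition coord_sum (R : realType) (n : nat) (S : {set 'I_n.+1})
    (x : 'rV[R]_n.+1) : R^o := \sum_(k in S) x 0 k.

Fact coord_sum_is_linear (R : realType) (n : nat) (S : {set 'I_n.+1}) :
  linear (@coord_sum R n S).
Proof.
move=> a x y; rewrite /coord_sum /GRing.scale /= mulr_sumr -big_split /=.
by apply: eq_bigr => k _; rewrite !mxE.
Qed.

HB.instance Definition _ (R : realType) (n : nat) (S : {set 'I_n.+1}) :=
  GRing.isLinear.Build R 'rV[R]_n.+1 R^o _ (@coord_sum R n S)
    (coord_sum_is_linear S).

Definition triangular (R : realType) (s : nat) : R :=
  2^-1 * s%:R * (s%:R + 1).
Arguments triangular R s : clear implicits.

Lemma cut_polytopeP (R : realType) (n : nat) (Fam : {set {set 'I_n.+1}})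
    (x : 'rV[R]_n.+1) :
  cut_polytope R Fam x <->
  (forall S, S \in Fam -> triangular R #|S| <= coord_sum S x) /\
  coord_sum finset.setT x = triangular R n.+1.
Proof.
have -> : coord_sum finset.setT x = \sum_(k < n.+1) x 0 k.
  by apply: eq_bigl => k; rewrite inE.
have -> : triangular R n.+1 = n.+1%:R * n.+2%:R / 2.
  by rewrite /triangular -[n.+2]addn1 natrD; field.
by split.
Qed.

(* The centre of the facet cut out by [S] of the permutahedron; [S = set0]
   gives the centre of the permutahedron. *)
Definition facet_center (R : realType) (n : nat) (S : {set 'I_n.+1}) :
    'rV[R]_n.+1 :=
  \row_k (if k \in S then (#|S|%:R + 1) / 2 else (n.+1%:R + #|S|%:R + 1) / 2).
Arguments facet_center R {n} S.

(** Twice the slack of the inequality of [T] at the centre, arranged so that every factor is visibly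
    nonnegative. *)
Lemma coord_sum_facet_center (R : realType) (n : nat) (S T : {set 'I_n.+1}) :
  2 * (coord_sum T (facet_center R S) - triangular R #|T|) =
  #|T :&: S|%:R * (#|S|%:R - #|T :&: S|%:R)
  + #|T :\: S|%:R * ((n.+1%:R - #|S|%:R - #|T :\: S|%:R)
                     + 2 * (#|S|%:R - #|T :&: S|%:R)).
Proof.
rewrite /triangular -(cardsID S T) natrD.
have -> : coord_sum T (facet_center R S) =
    #|T :&: S|%:R * ((#|S|%:R + 1) / 2)
    + #|T :\: S|%:R * ((n.+1%:R + #|S|%:R + 1) / 2).
  rewrite /coord_sum (big_setID S) /=; congr (_ + _).
    rewrite mulr_natl -sumr_const; apply: eq_bigr => k.
    by rewrite inE mxE => /andP[_ ->].
  rewrite mulr_natl -sumr_const; apply: eq_bigr => k.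
  by rewrite inE mxE => /andP[/negbTE ->].
by field.
Qed.

Lemma facet_center_total (R : realType) (n : nat) (S : {set 'I_n.+1}) :
  coord_sum finset.setT (facet_center R S) = triangular R n.+1.
Proof.
have := coord_sum_facet_center R S finset.setT.
rewrite finset.setTI finset.setTD !cardsT card_ord subrr !mulr0 addr0 add0r.
have -> : n.+1%:R - #|S|%:R = #|~: S|%:R :> R.
  by rewrite -[X in X%:R - _](card_ord n.+1) -(cardsC S) natrD addrAC subrr add0r.
rewrite subrr mulr0.
by move/eqP; rewrite mulf_eq0 pnatr_eq0 /= subr_eq0 => /eqP.
Qed.

Lemma facet_center_tight (R : realType) (n : nat) (S : {set 'I_n.+1}) :
  coord_sum S (facet_center R S) = triangular R #|S|.
Proof.
have := coord_sum_facet_center R S S.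
rewrite finset.setIid finset.setDv cards0 subrr mulr0 mul0r addr0.
by move/eqP; rewrite mulf_eq0 pnatr_eq0 /= subr_eq0 => /eqP.
Qed.

(** If [T] is contained in [S], the first product of [coord_sum_facet_center] is positive. Otherwise
    the second vanishes only if [T] contains both [S] and its complement. *)
Lemma facet_center_slack (R : realType) (n : nat) (S T : {set 'I_n.+1}) :
  T != finset.set0 -> T != finset.setT -> T != S ->
  triangular R #|T| < coord_sum T (facet_center R S).
Proof.
move=> T0 TT TS; rewrite -subr_gt0 -(pmulr_rgt0 _ (ltr0Sn R 1)).
rewrite coord_sum_facet_center.
set a := #|T :&: S|; set b := #|T :\: S|.
have aS : (a <= #|S|)%N by rewrite subset_leq_card ?finset.subsetIr.
have bS : (#|S| + b <= n.+1)%N.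
  apply: (@leq_trans (#|S| + #|~: S|)); last by rewrite cardsC card_ord.
  by rewrite leq_add2l subset_leq_card // finset.setDE finset.subsetIr.
have -> : n.+1%:R - #|S|%:R - b%:R = (n.+1 - (#|S| + b))%:R :> R.
  by rewrite natrB // natrD opprD addrA.
rewrite -natrB // -!natrM -!natrD -natrM -natrD ltr0n.
have [b0|b_gt0] := posnP b.
  have sTS : T \subset S by rewrite -finset.setD_eq0 -cards_eq0 -/b b0.
  have aT : a = #|T| by rewrite /a (finset.setIidPl sTS).
  have a_gt0 : (0 < a)%N by rewrite aT card_gt0.
  have a_lt : (a < #|S|)%N by rewrite aT proper_card // finset.properEneq TS.
  by rewrite addn_gt0 muln_gt0 a_gt0 subn_gt0 a_lt.
rewrite addn_gt0; apply/orP; right; rewrite muln_gt0 b_gt0 addn_gt0 muln_gt0 /= !subn_gt0.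
have [//|Sa] := ltnP a #|S|; first by rewrite orbT.
rewrite orbF ltn_neqAle bS andbT; apply: contra TT => /eqP E.
have aE : a = #|S| by apply/eqP; rewrite eqn_leq aS.
by rewrite eqEcard finset.subsetT /= cardsT card_ord -(cardsID S T) -/a -/b aE E.
Qed.

(** * Small displacements inside the polytope, and its direction space *)

Definition proper_family (n : nat) (Fam : {set {set 'I_n.+1}}) : Prop :=
  forall S, S \in Fam -> S != finset.set0 /\ S != finset.setT.

(** Only the inequalities tight at [x] restrict small displacements, and [v] is parallel to
    those. *)
Lemma cut_polytope_step (R : realType) (n : nat) (Fam : {set {set 'I_n.+1}})
    (x v : 'rV[R]_n.+1) :
  cut_polytope R Fam x -> coord_sum finset.setT v = 0 ->
  (forall S, S \in Fam ->
     triangular R #|S| < coord_sum S x \/ coord_sum S v = 0) ->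
  exists2 e : R, 0 < e &
    cut_polytope R Fam (x + e *: v) /\ cut_polytope R Fam (x - e *: v).
Proof.
move=> /cut_polytopeP[Hx xT] vT slack.
(* The choice of [e] below gives [e * r S <= 1] for all [S] at once. For a tight [S] the quotient is
   zero, division by zero being zero. *)
pose r S : R := `|coord_sum S v| / (coord_sum S x - triangular R #|S|).
have r0 S : S \in Fam -> 0 <= r S.
  by move=> SF; rewrite divr_ge0 // subr_ge0 Hx.
pose e := (1 + \sum_(S in Fam) r S)^-1.
have e_inv : 0 < 1 + \sum_(S in Fam) r S by rewrite ltr_pwDl // sumr_ge0.
have e0 : 0 < e by rewrite invr_gt0.
have small S : S \in Fam ->
    `|e * coord_sum S v| <= coord_sum S x - triangular R #|S|.
  move=> SF; case: (slack S SF) => [lt|->]; last by rewrite mulr0 normr0 subr_ge0 Hx.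
  have d0 : 0 < coord_sum S x - triangular R #|S| by rewrite subr_gt0.
  rewrite normrM (gtr0_norm e0) mulrC ler_pdivrMr // mulrC -ler_pdivrMr //.
  rewrite -/(r S) (bigD1 S) //= addrCA lerDl addr_ge0 // sumr_ge0 //.
  by move=> T /andP[TF _]; exact: r0.
exists e => //; split; apply/cut_polytopeP; split.
- move=> S SF; rewrite linearD linearZ /=.
  by have := small S SF; rewrite ler_norml => /andP[]; rewrite /GRing.scale /=; lra.
- by rewrite linearD linearZ /= vT scaler0 addr0.
- move=> S SF; rewrite linearB linearZ /=.
  by have := small S SF; rewrite ler_norml => /andP[]; rewrite /GRing.scale /=; lra.
- by rewrite linearB linearZ /= vT scaler0 subr0.
Qed.

Lemma facet_center_in (R : realType) (n : nat) (Fam : {set {set 'I_n.+1}})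
    (S : {set 'I_n.+1}) :
  proper_family Fam -> cut_polytope R Fam (facet_center R S).
Proof.
move=> prop; apply/cut_polytopeP; split; last exact: facet_center_total.
move=> T TF; have [T0 TT] := prop T TF.
have [->|TS] := eqVneq T S; first by rewrite facet_center_tight.
by rewrite ltW // facet_center_slack.
Qed.

(** At the centre of the permutahedron all inequalities are strict, so every direction of total zero
    can be followed. *)
Lemma dirspace_cut_polytope (R : realType) (n : nat)
    (Fam : {set {set 'I_n.+1}}) (v : 'rV[R]_n.+1) :
  proper_family Fam ->
  (v \in dirspace (cut_polytope R Fam)) = (coord_sum finset.setT v == 0).
Proof.
move=> prop; have [dir_in dir_min] := dirspaceP (cut_polytope R Fam).
apply/idP/eqP => [|vT].
  have : (dirspace (cut_polytope R Fam) <=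
          lker (linfun (@coord_sum R n finset.setT)))%VS.
    apply: dir_min => x y /cut_polytopeP[_ xT] /cut_polytopeP[_ yT].
    by rewrite memv_ker lfunE /= linearB /= xT yT subrr.
  by move=> /subvP sub /sub; rewrite memv_ker lfunE /= => /eqP.
have [S SF|e e0 [xv _]] :=
    cut_polytope_step (facet_center_in R finset.set0 prop) vT.
  by left; have [S0 ST] := prop S SF; exact: facet_center_slack.
have := dir_in _ _ (facet_center_in R finset.set0 prop) xv.
rewrite addrAC subrr add0r => /(memvZ e^-1).
by rewrite scalerA mulVf ?scale1r ?gt_eqF.
Qed.

(** The functional e_S on the direction space. Constant functionals vanish there when all its
    vectors have total zero, which gives the quotient by constants. *)
Definition coord_functional (R : realType) (n : nat) (P : set 'rV[R]_n.+1)
    (S : {set 'I_n.+1}) : normal_space P :=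
  (linfun (@coord_sum R n S) \o linfun (vsval (U := dirspace P)))%VF.

Lemma coord_functionalE (R : realType) (n : nat) (P : set 'rV[R]_n.+1)
    (S : {set 'I_n.+1}) (v : 'rV[R]_n.+1) :
  v \in dirspace P ->
  (coord_functional P S : 'Hom(_, _)) (vsproj (dirspace P) v) = coord_sum S v.
Proof. by move=> vP; rewrite /coord_functional lfunE /= !lfunE /= vsprojK. Qed.

Lemma normal_space_eq (R : realType) (n : nat) (P : set 'rV[R]_n.+1)
    (c d : 'Hom(subvs_of (dirspace P), R^o)) :
  (forall v, v \in dirspace P ->
     c (vsproj (dirspace P) v) = d (vsproj (dirspace P) v)) -> c = d.
Proof.
by move=> cd; apply/lfunP => v; rewrite -(vsvalK v); apply: cd; exact: subvsP.
Qed.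

Lemma coord_functional_neq0 (R : realType) (n : nat)
    (Fam : {set {set 'I_n.+1}}) (S : {set 'I_n.+1}) :
  proper_family Fam -> S \in Fam ->
  coord_functional (cut_polytope R Fam) S != 0.
Proof.
move=> prop SF; have [S0 ST] := prop S SF; apply/negP => /eqP /lfunP.
move=> /(_ (vsproj _ (facet_center R finset.set0 - facet_center R S))).
rewrite coord_functionalE; last first.
  by rewrite dirspace_cut_polytope // linearB /= !facet_center_total subrr.
rewrite linearB /= facet_center_tight zero_lfunE => /eqP.
by rewrite subr_eq0 gt_eqF // facet_center_slack // eq_sym.
Qed.

Definition ray (R : realType) (V : vectType R) (c : V) : set V :=
  [set t *: c | t in [set t : R | 0 <= t]].

(** The polytope contains a segment centred at [x] in the direction [v], and [c] is maximal at
    [x]. *)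
Lemma normal_functional_vanish (R : realType) (n : nat)
    (Fam : {set {set 'I_n.+1}}) (x v : 'rV[R]_n.+1)
    (c : 'Hom(subvs_of (dirspace (cut_polytope R Fam)), R^o)) :
  cut_polytope R Fam x ->
  (forall y, cut_polytope R Fam y -> c (vsproj _ (y - x)) <= 0) ->
  coord_sum finset.setT v = 0 ->
  (forall S, S \in Fam ->
     triangular R #|S| < coord_sum S x \/ coord_sum S v = 0) ->
  c (vsproj _ v) = 0.
Proof.
move=> Px cx vT slack.
have [e e0 [/cx up /cx down]] := cut_polytope_step Px vT slack.
have cZ a : c (vsproj _ (a *: v)) = a * c (vsproj _ v) by rewrite !linearZ.
move: up down; rewrite -scaleNr ![_ - x]addrC !addKr !cZ mulNr.
rewrite oppr_le0 pmulr_rle0 // pmulr_rge0 // => c0 c1.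
by apply/eqP; rewrite eq_le c0.
Qed.

(** At the facet centre only the inequality of [S] is tight, so a normal functional vanishes on the
    kernel of e_S. The sign is negative because normal cones use maxima whereas the inequalities
    bound e_S from below. *)
Lemma facet_ray_in_fan (R : realType) (n : nat) (Fam : {set {set 'I_n.+1}})
    (S : {set 'I_n.+1}) :
  proper_family Fam -> S \in Fam ->
  normal_fan (cut_polytope R Fam)
    (ray (- coord_functional (cut_polytope R Fam) S)).
Proof.
move=> prop SF; set P := cut_polytope R Fam.
have [S0 ST] := prop S SF.
pose x0 := facet_center R S; pose z := facet_center R (finset.set0 : {set 'I_n.+1}).
have Px0 : P x0 by exact: facet_center_in.
have Pz : P z by exact: facet_center_in.
have dirP x y : P x -> P y -> y - x \in dirspace P by case: (dirspaceP P) => + _; apply.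
pose F : set 'rV[R]_n.+1 := [set x | P x /\ coord_sum S x = triangular R #|S|].
exists F.
  split; first by exists x0; split=> //; exact: facet_center_tight.
  exists (- linfun (@coord_sum R n S)).
  apply/seteqP; split=> x [Px].
    move=> Sx; split=> // y /cut_polytopeP[Hy _].
    by rewrite !opp_lfunE !lfunE /= lerN2 Sx Hy.
  move=> /(_ _ Px0); rewrite !opp_lfunE !lfunE /= lerN2 facet_center_tight => xS.
  by split=> //; apply/eqP; rewrite eq_le xS; move/cut_polytopeP: Px => [-> //].
apply/seteqP; split=> [_ [t t0 <-]|c Hc].
  move=> x y [Px xS] Py; rewrite scale_lfunE opp_lfunE coord_functionalE ?dirP //.
  rewrite linearB /= xS scalerN oppr_le0 mulr_ge0 // subr_ge0.
  by move/cut_polytopeP: Py => [-> //].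
have Fx0 : F x0 by split=> //; exact: facet_center_tight.
have cx0 y : P y -> c (vsproj (dirspace P) (y - x0)) <= 0 by exact: Hc.
have zT : coord_sum finset.setT (z - x0) = 0.
  by rewrite linearB /= !facet_center_total subrr.
have zS : 0 < coord_sum S (z - x0).
  by rewrite linearB /= facet_center_tight subr_gt0 facet_center_slack // eq_sym.
(* Evaluating at [z - x0], which points into the polytope, determines the coefficient; subtracting
   [a *: (z - x0)] from [v] then makes it parallel to the facet. *)
pose t := - c (vsproj (dirspace P) (z - x0)) / coord_sum S (z - x0).
exists t; first by rewrite /= divr_ge0 ?oppr_ge0 ?cx0 // ltW.
apply: normal_space_eq => v vP; rewrite scale_lfunE opp_lfunE coord_functionalE //.
have vT : coord_sum finset.setT v = 0.
  by apply/eqP; rewrite -(dirspace_cut_polytope v prop).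
pose a := coord_sum S v / coord_sum S (z - x0).
have cB w : c (vsproj (dirspace P) (v - a *: w)) =
    c (vsproj (dirspace P) v) - a * c (vsproj (dirspace P) w).
  by rewrite linearB linearZ linearB linearZ.
have : c (vsproj (dirspace P) (v - a *: (z - x0))) = 0.
  apply: (normal_functional_vanish Px0 cx0).
    by rewrite linearB linearZ /= vT zT scaler0 subrr.
  move=> T TF; have [T0 TT] := prop T TF.
  have [->|TS] := eqVneq T S; last by left; exact: facet_center_slack.
  right; rewrite linearB linearZ /= /GRing.scale /= /a divfK ?subrr //.
  by rewrite gt_eqF.
rewrite cB => /eqP; rewrite subr_eq0 => /eqP ->.
by rewrite /GRing.scale /= /t mulNr mulrNN [RHS]mulrC mulrA mulrAC.
Qed.

(** If some inequality is tight on the whole face, its normal lies in the cone and hence is a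
    multiple of [c]. Otherwise the face has a point where all inequalities are strict, and [c]
    vanishes. *)
Lemma ray_in_fan_facet (R : realType) (n : nat) (Fam : {set {set 'I_n.+1}})
    (c : normal_space (cut_polytope R Fam)) :
  proper_family Fam -> c != 0 -> normal_fan (cut_polytope R Fam) (ray c) ->
  exists S t, [/\ S \in Fam, 0 < t
    & c = t *: - coord_functional (cut_polytope R Fam) S].
Proof.
move=> prop; set P := cut_polytope R Fam => cn0 [F [[x0 Fx0] [c0 FE]] rayE].
have FP x : F x -> P x by rewrite FE => -[].
have dirP x y : P x -> P y -> y - x \in dirspace P by case: (dirspaceP P) => + _; apply.
have Fmid x y : F x -> F y -> F (2^-1 *: (x + y)).
  rewrite FE => -[/cut_polytopeP[Hx xT] cx] [/cut_polytopeP[Hy yT] cy].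
  split; first apply/cut_polytopeP; first split.
  - move=> S SF; rewrite linearZ linearD /= /GRing.scale /=.
    by have := Hx S SF; have := Hy S SF; lra.
  - by rewrite linearZ linearD /= xT yT /GRing.scale /=; field.
  - move=> y' Py'; rewrite linearZ linearD /= /GRing.scale /=.
    by have := cx y' Py'; have := cy y' Py'; lra.
have [[S SF tight]|none] := pselect (exists2 S, S \in Fam &
    forall x, F x -> coord_sum S x = triangular R #|S|).
  have : normal_cone P F (- coord_functional P S).
    move=> x y Fx Py; have xy := dirP x y (FP x Fx) Py.
    rewrite opp_lfunE coord_functionalE //.
    rewrite linearB /= (tight x Fx) oppr_le0 subr_ge0.
    by move/cut_polytopeP: Py => [-> //].
  rewrite -rayE => -[t t0 tE].
  have chi0 := coord_functional_neq0 R prop SF.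
  have tn0 : t != 0.
    apply: contraNneq chi0 => t00; move: tE; rewrite t00 scale0r => /esym /eqP.
    by rewrite oppr_eq0.
  exists S, t^-1; split=> //; first by rewrite invr_gt0 lt_def tn0.
  by rewrite -tE scalerA mulVf // scale1r.
(* Averaging with further points of [F] makes the inequalities strict one after the other. *)
have slack : exists2 x, F x & forall S, S \in Fam -> triangular R #|S| < coord_sum S x.
  have ge S x : S \in Fam -> F x -> triangular R #|S| <= coord_sum S x.
    by move=> SF /FP /cut_polytopeP[Hx _]; exact: Hx.
  have : {subset enum Fam <= Fam} by move=> S; rewrite mem_enum.
  suff H (s : seq {set 'I_n.+1}) : {subset s <= Fam} ->
      exists2 x, F x & forall S, S \in s -> triangular R #|S| < coord_sum S x.
    by move=> /H[x Fx Hx]; exists x => // S SF; apply: Hx; rewrite mem_enum.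
  elim: s => [|S s IH] sub; first by exists x0.
  have [x Fx Hx] : exists2 x, F x &
      forall S, S \in s -> triangular R #|S| < coord_sum S x.
    by apply: IH => T Ts; apply: sub; rewrite inE Ts orbT.
  have SF : S \in Fam by apply: sub; rewrite mem_head.
  have [y Fy Sy] : exists2 y, F y & triangular R #|S| < coord_sum S y.
    apply: contrapT => no; apply: none; exists S => // y Fy; apply/eqP.
    rewrite eq_le (ge S y SF Fy) andbT leNgt; apply/negP => lt.
    by apply: no; exists y.
  exists (2^-1 *: (x + y)); first exact: Fmid.
  move=> T; rewrite inE linearZ linearD /= /GRing.scale /= => /orP[/eqP ->|Ts].
    by have := ge S x SF Fx; lra.
  by have := Hx T Ts; have := ge T y (sub T _) Fy; rewrite inE Ts orbT => /(_ isT); lra.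
case: slack => x Fx Hx; case/negP: cn0; apply/eqP.
have cC : normal_cone P F c.
  by rewrite -rayE; exists 1; [exact: ler01 | rewrite scale1r].
apply: normal_space_eq => v vP; rewrite zero_lfunE.
apply: (normal_functional_vanish (FP x Fx)) => [y Py||S SF].
- exact: cC.
- by apply/eqP; rewrite -(dirspace_cut_polytope v prop).
- by left; exact: Hx.
Qed.

(** * Fan isomorphisms as signed permutations *)

Lemma fan_map_facet (R : realType) (n : nat) (Fam Fam' : {set {set 'I_n.+1}})
    (f : 'Hom(normal_space (cut_polytope R Fam), normal_space (cut_polytope R Fam')))
    (S : {set 'I_n.+1}) :
  proper_family Fam -> proper_family Fam' -> injective f ->
  (forall C, normal_fan (cut_polytope R Fam) C ->
     normal_fan (cut_polytope R Fam') [set f c | c in C]) ->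
  S \in Fam -> exists T t, [/\ T \in Fam', 0 < t &
    f (coord_functional _ S) = t *: coord_functional _ T].
Proof.
move=> prop prop' f_inj fan SF; set c := coord_functional _ S.
have fray : [set f d | d in ray (- c)] = ray (f (- c)).
  apply/seteqP; split=> [_ [_ [t t0 <-] <-]|_ [t t0 <-]].
    by exists t; rewrite // linearZ.
  by exists (t *: - c); [exists t | rewrite linearZ].
have c0 : c != 0 := coord_functional_neq0 R prop SF.
have := fan _ (facet_ray_in_fan R prop SF); rewrite fray => /ray_in_fan_facet.
case=> // [|T [t [TF t0 fE]]].
  by apply: contraNneq c0 => fc0; rewrite -oppr_eq0; apply/eqP/f_inj; rewrite fc0 linear0.
exists T, t; split=> //; apply: oppr_inj.
by rewrite -scalerN -fE linearN.
Qed.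

(** The coordinate of e_S along w_k, as shown by [coord_functional_jump]. *)
Definition jump (R : realType) (n : nat) (S : {set 'I_n.+1}) (k : 'I_n) : R :=
  (widen_ord (leqnSn n) k \in S)%:R - (lift ord0 k \in S)%:R.
Arguments jump R {n} S k.

Definition initial (n : nat) (k : 'I_n) : {set 'I_n.+1} :=
  [set q : 'I_n.+1 | (q <= k)%N].

Lemma jump_initial (R : realType) (n : nat) (m k : 'I_n) :
  jump R (initial m) k = (k == m)%:R.
Proof.
rewrite /jump !inE /= /bump leq0n add1n -val_eqE /=.
by have [km|km|km] := ltngtP k m; rewrite ?subrr ?subr0 // leqNgt km subrr.
Qed.

Lemma jumpC (R : realType) (n : nat) (S : {set 'I_n.+1}) (k : 'I_n) :
  jump R (~: S) k = - jump R S k.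
Proof.
by rewrite /jump !inE; case: (_ \in S); case: (_ \in S);
  rewrite /= ?subrr ?subr0 ?sub0r ?opprK ?oppr0.
Qed.

Lemma jump_telescope (R : realType) (n : nat) (S : {set 'I_n.+1}) (q : 'I_n.+1) :
  \sum_(k < n | (q <= k)%N) jump R S k = (q \in S)%:R - (ord_max \in S)%:R.
Proof.
pose f k : R := (inord k \in S)%:R.
have -> : \sum_(k < n | (q <= k)%N) jump R S k = \sum_(q <= k < n) (f k - f k.+1).
  rewrite big_geq_mkord; apply: eq_bigr => k _; rewrite /jump /f.
  have -> : inord k = widen_ord (leqnSn n) k.
    by apply: val_inj; rewrite /= inordK // ltnS ltnW.
  have -> // : inord k.+1 = lift ord0 k.
  by apply: val_inj; rewrite /= inordK // ltnS.
have -> : (q \in S)%:R - (ord_max \in S)%:R = f q - f n :> R.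
  rewrite /f inord_val; congr (_ - (_ \in S)%:R).
  by apply: val_inj; rewrite /= inordK.
rewrite -opprB -telescope_sumr ?leq_ord // -sumrN.
by apply: eq_bigr => k _; rewrite opprB.
Qed.

(** These vectors form the dual basis: evaluation at [gap R k] reads off the coordinate along
    w_k. *)
Definition gap (R : realType) (n : nat) (k : 'I_n) : 'rV[R]_n.+1 :=
  delta_mx 0 (widen_ord (leqnSn n) k) - delta_mx 0 (lift ord0 k).
Arguments gap R {n} k.

Lemma coord_sum_gap (R : realType) (n : nat) (S : {set 'I_n.+1}) (k : 'I_n) :
  coord_sum S (gap R k) = jump R S k.
Proof.
have delta q : coord_sum S (delta_mx 0 q : 'rV[R]_n.+1) = (q \in S)%:R.
  rewrite /coord_sum; case qS: (q \in S).
    rewrite (bigD1 q) //= mxE !eqxx big1 ?addr0 // => l /andP[_ /negbTE lq].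
    by rewrite mxE lq andbF.
  rewrite big1 // => l lS; rewrite mxE eqxx /=; case: eqP => // lq.
  by rewrite lq qS in lS.
by rewrite linearB /= !delta.
Qed.

(** Summation by parts: as the entries of [v] sum to zero, the indicator of [S] may be normalized to
    vanish at the last coordinate. *)
Lemma coord_functional_jump (R : realType) (n : nat) (Fam : {set {set 'I_n.+1}})
    (S : {set 'I_n.+1}) :
  proper_family Fam ->
  coord_functional (cut_polytope R Fam) S =
  \sum_(k < n) jump R S k *: coord_functional (cut_polytope R Fam) (initial k).
Proof.
move=> prop; apply: normal_space_eq => v vP; rewrite sum_lfunE coord_functionalE //.
have vT : \sum_q v 0 q = 0.
  move: vP; rewrite dirspace_cut_polytope // => /eqP vT0.
  by rewrite -[RHS]vT0; apply: eq_big => // k; rewrite inE.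
transitivity (\sum_q v 0 q * ((q \in S)%:R - (ord_max \in S)%:R)).
  under eq_bigr do rewrite mulrBr.
  rewrite sumrB -mulr_suml vT mul0r subr0 /coord_sum big_mkcond /=.
  by apply: eq_bigr => q _; case: ifP; rewrite ?mulr1 ?mulr0.
under eq_bigr do rewrite -jump_telescope mulr_sumr big_mkcond.
rewrite exchange_big /=; apply: eq_bigr => k _.
rewrite scale_lfunE coord_functionalE // /GRing.scale /= /coord_sum mulr_sumr.
rewrite [RHS]big_mkcond /=; apply: eq_bigr => q _.
by rewrite inE; case: ifP; rewrite // mulrC.
Qed.

Lemma coord_functional_gap (R : realType) (n : nat) (Fam : {set {set 'I_n.+1}})
    (S : {set 'I_n.+1}) (k : 'I_n) :
  proper_family Fam ->
  (coord_functional (cut_polytope R Fam) S : 'Hom(_, _)) (vsproj _ (gap R k)) =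
  jump R S k.
Proof.
move=> prop; rewrite coord_functionalE ?coord_sum_gap // dirspace_cut_polytope //.
by rewrite coord_sum_gap /jump !inE subrr.
Qed.

Lemma coord_functionalC (R : realType) (n : nat) (Fam : {set {set 'I_n.+1}})
    (S : {set 'I_n.+1}) :
  proper_family Fam ->
  coord_functional (cut_polytope R Fam) (~: S) =
  - coord_functional (cut_polytope R Fam) S.
Proof.
move=> prop; rewrite !coord_functional_jump // -sumrN.
by apply: eq_bigr => k _; rewrite jumpC scaleNr.
Qed.

Lemma admissible_proper (n : nat) (u : 'I_n.+1 -> bool) :
  proper_family (admissible u).
Proof. by move=> S; rewrite inE => /and3P[]. Qed.

Lemma ord_step_const (n : nat) (f : 'I_n.+1 -> bool) :
  (forall k : 'I_n, f (widen_ord (leqnSn n) k) = f (lift ord0 k)) ->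
  forall q, f q = f ord0.
Proof.
move=> step [q qn]; elim: q qn => [|q IH] qn; first by congr f; exact: val_inj.
have qn' : (q < n)%N by [].
rewrite -(IH (ltnW qn)); transitivity (f (lift ord0 (Ordinal qn'))).
  by congr f; exact: val_inj.
by rewrite -step; congr f; exact: val_inj.
Qed.

(** The two indicators jump at the same places, so their exclusive or is constant. Were it false,
    [S] and [T] would coincide, all jumps would vanish, and [S] would be empty or full. *)
Lemma jump_opposite (R : realType) (n : nat) (S T : {set 'I_n.+1}) (s t : R) :
  S != finset.set0 -> S != finset.setT -> 0 < s -> 0 < t ->
  (forall k, s * jump R S k = - (t * jump R T k)) -> T = ~: S.
Proof.
move=> S0 ST s0 t0 E.
have xorE (k : 'I_n) : (widen_ord (leqnSn n) k \in S) (+) (widen_ord (leqnSn n) k \in T)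
    = (lift ord0 k \in S) (+) (lift ord0 k \in T).
  move: (E k); rewrite /jump; do 4 case: (_ \in _); move=> //= Ek; exfalso; lra.
have {}xorE := @ord_step_const n (fun q => (q \in S) (+) (q \in T)) xorE.
have [all_ne|all_eq] := boolP ((ord0 \in S) (+) (ord0 \in T)).
  apply/setP => q; rewrite inE; have := xorE q; rewrite all_ne.
  by case: (q \in S); case: (q \in T).
have Sconst : forall q, (q \in S) = (ord0 \in S).
  apply: (@ord_step_const n (fun q => q \in S)) => k.
  move: (E k) (xorE (widen_ord (leqnSn n) k)) (xorE (lift ord0 k)).
  rewrite (negbTE all_eq) /jump; do 4 case: (_ \in _); move=> //= Ek _ _; exfalso; lra.
case: (boolP (ord0 \in S)) => S00.
  by case/negP: ST; apply/eqP/setP => q; rewrite Sconst S00 inE.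
by case/negP: S0; apply/eqP/setP => q; rewrite Sconst (negbTE S00) inE.
Qed.

Lemma jump_proportional (R : realType) (n : nat) (S T : {set 'I_n.+1}) (s t : R) :
  S != finset.set0 -> S != finset.setT -> 0 < s -> 0 < t ->
  (forall k, s * jump R S k = t * jump R T k) -> S = T.
Proof.
move=> S0 ST s0 t0 E; apply: finset.setC_inj.
have := @jump_opposite R n S (~: T) s t S0 ST s0 t0.
by move=> -> // k; rewrite jumpC mulrN opprK.
Qed.

(** Membership changes only once along the coordinates, so one between two of equal membership
    follows them whatever its sign. *)
Lemma initial_admissible (n : nat) (u : 'I_n.+1 -> bool) (m : 'I_n) :
  initial m \in admissible u /\ ~: initial m \in admissible u.
Proof.
have m0 : ord0 \in initial m by rewrite inE.
have mn : ord_max \notin initial m by rewrite inE /= -ltnNge.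
split; apply/admissibleP; split.
- by exists ord0.
- by exists ord_max.
- by move=> i j k /andP[ij jk]; rewrite !inE; case: (u j); lia.
- by exists ord_max; rewrite inE mn.
- by exists ord0; rewrite inE negbK.
- by move=> i j k /andP[ij jk]; rewrite !inE; case: (u j); lia.
Qed.

(** The two conditions together no longer involve signs: a coordinate between two of equal
    membership follows them, so membership changes only once. This characterizes the pairs of
    opposite rays. *)
Lemma admissible_complementary (n : nat) (u : 'I_n.+1 -> bool)
    (S : {set 'I_n.+1}) :
  S \in admissible u -> ~: S \in admissible u ->
  exists m, S = initial m \/ S = ~: initial m.
Proof.
move=> /admissibleP[[k1 k1S] [k0 k0S] H] /admissibleP[_ _ H'].
have conv (i j k : 'I_n.+1) : (i < j < k)%N -> (i \in S) = (k \in S) ->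
    (j \in S) = (i \in S).
  move=> ijk iSk; have := H i j k ijk; have := H' i j k ijk; rewrite !inE -iSk.
  by case: (u j); case: (i \in S); case: (j \in S) => //= h1 h2;
    rewrite ?h1 ?h2 // -?h1 -?h2.
have ends : (ord0 \in S) != (ord_max \in S).
  apply/negP => /eqP e; have const q : (q \in S) = (ord0 \in S).
    have [->//|q0] := eqVneq q ord0; have [->//|qn] := eqVneq q ord_max.
    apply: (conv ord0 q ord_max) => //=; rewrite lt0n q0 /=.
    by rewrite ltn_neqAle qn -ltnS ltn_ord.
  by move: k0S; rewrite const -(const k1) k1S.
have [m0 /eqP mS mmax] := ord_argmax (P := fun q => (q \in S) == (ord0 \in S))
  (eqxx (ord0 \in S)).
have mn : (m0 < n)%N.
  rewrite ltn_neqAle -ltnS ltn_ord andbT; apply: contraNneq ends => m0n.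
  by rewrite -mS (_ : m0 = ord_max) //; exact: val_inj.
have low (q : 'I_n.+1) : (q <= m0)%N -> (q \in S) = (ord0 \in S).
  rewrite leq_eqVlt => /orP[/eqP/val_inj -> //|qm].
  have [->//|q0] := eqVneq q ord0.
  by apply: (conv ord0 q m0); rewrite ?qm ?andbT ?lt0n.
have high (q : 'I_n.+1) : (m0 < q)%N -> (q \in S) = ~~ (ord0 \in S).
  move=> mq; have : (q \in S) != (ord0 \in S).
    by apply: contraTN mq => /mmax; rewrite -leqNgt.
  by case: (q \in S); case: (ord0 \in S).
exists (Ordinal mn); case S0: (ord0 \in S) in low high *; [left|right];
  apply/setP => q; rewrite !inE /=;
  by have [/low|/high] := leqP q m0.
Qed.

Lemma jump_neq0 (R : realType) (n : nat) (S : {set 'I_n.+1}) :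
  S != finset.set0 -> S != finset.setT -> exists k, jump R S k != 0.
Proof.
move=> S0 ST; apply: contrapT => none.
have Sconst q : (q \in S) = (ord0 \in S).
  apply: (@ord_step_const n (fun q => q \in S)) => k.
  have [/eqP|jk] := eqVneq (jump R S k) 0; last by case: none; exists k.
  by rewrite /jump subr_eq0 eqr_nat; do 2 case: (_ \in S).
case: (boolP (ord0 \in S)) => S00.
  by case/negP: ST; apply/eqP/setP => q; rewrite Sconst S00 inE.
by case/negP: S0; apply/eqP/setP => q; rewrite Sconst (negbTE S00) inE.
Qed.

Lemma jump_values (R : realType) (n : nat) (S : {set 'I_n.+1}) (k : 'I_n) :
  jump R S k != 0 -> `|jump R S k| = 1.
Proof.
by rewrite /jump; do 2 case: (_ \in S);
  rewrite /= ?subrr ?subr0 ?sub0r ?eqxx ?normrN1 ?normr1.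
Qed.

Lemma jump_sum (R : realType) (n : nat) (S : {set 'I_n.+1}) :
  `|\sum_(k < n) jump R S k| <= 1.
Proof.
have := jump_telescope R S ord0; rewrite (eq_bigl xpredT) // => ->.
by do 2 case: (_ \in S); rewrite /= ?subrr ?subr0 ?sub0r ?normrN1 ?normr1 ?normr0.
Qed.

(* The label [k.+1] alone, or all the others, according to its sign. *)
Lemma adjacent_admissible (R : realType) (n : nat) (u : 'I_n.+1 -> bool)
    (k l : 'I_n) :
  l = k.+1 :> nat ->
  exists2 S, S \in admissible u &
    forall m, jump R S m =
      (-1) ^+ (u (lift ord0 k)) * ((m == l)%:R - (m == k)%:R).
Proof.
move=> lk; set q := lift ord0 k.
have qE : q = k.+1 :> nat by [].
have mem m : (widen_ord (leqnSn n) m == q) = (m == l) /\ (lift ord0 m == q) = (m == k).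
  by rewrite -!val_eqE /= /bump leq0n add1n lk eqSS.
have l_lt := ltn_ord l.
case uq : (u q).
  exists (~: [set q]%SET).
    apply/admissibleP; split.
    - by exists ord0; rewrite !inE -val_eqE.
    - by exists q; rewrite !inE eqxx.
    move=> i j m /andP[ij jm]; rewrite !inE.
    have [jq|jq] := eqVneq j q; last by rewrite -!val_eqE /= in jq *; case: (u j); lia.
    by rewrite jq uq -jq -val_eqE /= ltn_eqF.
  move=> m; rewrite jumpC /jump !inE !(mem m).1 !(mem m).2.
  by rewrite expr1 mulN1r.
exists [set q]%SET.
  apply/admissibleP; split.
  - by exists q; rewrite !inE eqxx.
  - by exists ord0; rewrite !inE -val_eqE.
  move=> i j m /andP[ij jm]; rewrite !inE.
  have [jq|jq] := eqVneq j q; last by rewrite -!val_eqE /= in jq *; case: (u j); lia.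
  by rewrite jq uq -jq -val_eqE /= ltn_eqF.
by move=> m; rewrite /jump !inE !(mem m).1 !(mem m).2 expr0 mul1r.
Qed.

(** Opposite rays go to opposite rays, so the basis w_k is permuted up to scalars [c k]. Comparing
    coordinates on the rays that involve two adjacent basis vectors makes these scalars equal, and
    only their common sign remains. *)
Lemma normally_isomorphic_signed_perm (R : realType) (n : nat)
    (u u' : 'I_n.+1 -> bool) :
  normally_isomorphic (cut_polytope R (admissible u))
    (cut_polytope R (admissible u')) ->
  exists (tau : 'I_n -> 'I_n) (e : bool), injective tau /\
    forall S, S \in admissible u -> exists2 T, T \in admissible u' &
      forall k, jump R T (tau k) = (-1) ^+ e * jump R S k.
Proof.
case=> f f_bij fan.
have prop := @admissible_proper n u; have prop' := @admissible_proper n u'.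
have f_inj := bij_inj f_bij.
pose chi := coord_functional (cut_polytope R (admissible u)).
pose chi' := coord_functional (cut_polytope R (admissible u')).
pose gap' k (c : 'Hom(subvs_of (dirspace (cut_polytope R (admissible u'))), R^o)) : R :=
  c (vsproj _ (gap R k)).
have gapZ k t c : gap' k (t *: c) = t * gap' k c by rewrite /gap' scale_lfunE.
have gap_chi' S k : gap' k (chi' S) = jump R S k by exact: coord_functional_gap.
have facet S : S \in admissible u ->
    exists T t, [/\ T \in admissible u', 0 < t & f (chi S) = t *: chi' T].
  exact: fan_map_facet.
(* The image of the pair given by an initial set and its complement is another such pair, with a
   negative scalar when the roles are exchanged. *)
have axis k : exists mc : 'I_n * R,
    mc.2 != 0 /\ f (chi (initial k)) = mc.2 *: chi' (initial mc.1).
  have [ini inic] := initial_admissible u k.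
  have [T [t [TF t0 fT]]] := facet _ ini.
  have [T' [t' [T'F t'0 fT']]] := facet _ inic.
  have T'E : T' = ~: T.
    have [T0 TT] := prop' T TF; apply: (jump_opposite T0 TT t0 t'0) => m.
    rewrite -!gap_chi' -!gapZ -fT -fT'.
    by rewrite /chi coord_functionalC // linearN /gap' opp_lfunE opprK.
  rewrite T'E in T'F; have [m [TE|TE]] := admissible_complementary TF T'F.
    by exists (m, t); split; rewrite ?gt_eqF //= fT TE.
  exists (m, - t); split; first by rewrite oppr_eq0 gt_eqF.
  by rewrite fT TE /chi' coord_functionalC // scalerN scaleNr.
have [mc mcP] := choice axis.
pose tau k := (mc k).1; pose c k := (mc k).2.
have c0 k : c k != 0 by case: (mcP k).
have fE k : f (chi (initial k)) = c k *: chi' (initial (tau k)) by case: (mcP k).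
(* Basis functionals sent to the same axis would be proportional. *)
have tau_inj : injective tau.
  move=> k l kl; apply/eqP; apply: contraT => /negbTE nkl.
  have /lfunP/(_ (vsproj _ (gap R k))) : c l *: chi (initial k) = c k *: chi (initial l).
    by apply: f_inj; rewrite !linearZ /= !fE -kl !scalerA mulrC.
  rewrite !scale_lfunE !coord_functional_gap // !jump_initial eqxx nkl.
  by rewrite /GRing.scale /= mulr1 mulr0 => /eqP; rewrite (negbTE (c0 l)).
have key S : S \in admissible u -> exists T t, [/\ T \in admissible u', 0 < t &
    forall j, c j * jump R S j = t * jump R T (tau j)].
  move=> /facet[T [t [TF t0 fT]]]; exists T, t; split=> // j.
  rewrite -[jump R T _]gap_chi' -gapZ -fT /chi coord_functional_jump //.
  rewrite linear_sum /gap' sum_lfunE.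
  rewrite (bigD1 j) //= big1 ?addr0 => [|k kj];
    rewrite linearZ /= -/(chi _) fE -/(gap' _ _) !gapZ gap_chi' jump_initial.
    by rewrite eqxx mulr1 mulrC.
  by rewrite (inj_eq tau_inj) eq_sym (negbTE kj) !mulr0.
(* Nonzero jumps have absolute value 1, so the scalars at the jumps of one set all have absolute
   value [t]. *)
have abs_t S T t : 0 < t -> (forall j, c j * jump R S j = t * jump R T (tau j)) ->
    forall j, jump R S j != 0 -> `|c j| = t.
  move=> t0 E j Sj; have Tj : jump R T (tau j) != 0.
    apply: contraNneq (mulf_neq0 (c0 j) Sj) => Tj0.
    by rewrite E Tj0 mulr0.
  have := congr1 Num.norm (E j); rewrite !normrM !jump_values // !mulr1 => ->.
  by rewrite gtr0_norm.
(* The set isolating the label between [k] and [l] has two jumps of opposite signs. Opposite scalars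
   would turn them into equal ones, and the total jump of the image would be 2 in absolute value,
   against [jump_sum]. *)
have c_step (k l : 'I_n) : l = k.+1 :> nat -> c k = c l.
  move=> lk; have [S /key[T [t [_ t0 E]]] Sm] := adjacent_admissible R u lk.
  have kl : (k == l) = false by rewrite -val_eqE /= lk ltn_eqF.
  set s := (-1) ^+ _ in Sm; have s0 : s != 0 by rewrite signr_eq0.
  have ck : `|c k| = t.
    by apply: (abs_t _ _ _ t0 E); rewrite Sm kl eqxx sub0r mulrN1 oppr_eq0.
  have cl : `|c l| = t.
    by apply: (abs_t _ _ _ t0 E); rewrite Sm eqxx [l == k]eq_sym kl subr0 mulr1.
  have : t * \sum_m jump R T m = s * (c l - c k).
    rewrite (reindex_inj tau_inj) mulr_sumr /=.
    transitivity (\sum_m (s * ((m == l)%:R * c m) - s * ((m == k)%:R * c m))).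
      by apply: eq_bigr => m _; rewrite -E Sm; ring.
    by rewrite sumrB -!mulr_sumr !sum_delta mulrBr.
  move=> /(congr1 Num.norm); rewrite !normrM normr_sign mul1r (gtr0_norm t0) => sumE.
  have : `|c l - c k| <= t by rewrite -sumE ler_piMr ?jump_sum // ltW.
  have pm x : `|x| = t -> x = t \/ x = - t.
    move=> <-; have [x0|x0] := leP 0 x; [left|right].
      by rewrite ger0_norm.
    by rewrite ltr0_norm ?opprK.
  have [-> //|->] := pm _ ck; have [-> //|->] := pm _ cl => //;
    by rewrite ler_norml => /andP[]; lra.
have c_const k l : c k = c l.
  have n0 : (0 < n)%N by apply: leq_ltn_trans (ltn_ord k).
  suff H m (mn : (m < n)%N) : c (Ordinal mn) = c (Ordinal n0).
    by case: k l => k kn [l ln]; rewrite !H.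
  elim: m mn => [|m IH] mn; first by congr c; exact: val_inj.
  by rewrite -(IH (ltnW mn)); apply/esym/c_step.
exists tau, [exists k, c k < 0]; split=> // S SF.
have [T [t [TF t0 E]]] := key S SF; exists T => // k.
have [S0 ST] := prop S SF; have [j Sj] := jump_neq0 R S0 ST.
have ck : `|c k| = t by rewrite (c_const k j) (abs_t _ _ _ t0 E).
apply: (mulfI (lt0r_neq0 t0)); rewrite -E mulrA; congr (_ * _).
case: existsP => [[l cl]|nonneg].
  by rewrite expr1 mulrN1 -ck ltr0_norm ?opprK // (c_const k l).
have ck0 : 0 <= c k by rewrite leNgt; apply/negP => ck0; apply: nonneg; exists k.
by rewrite expr0 mulr1 -ck ger0_norm.
Qed.

(** * Recovering the signs *)

(** For [a < b] its functional is w_b - w_a. *)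
Definition interval_set (n : nat) (a b : 'I_n) : {set 'I_n.+1} :=
  [set q : 'I_n.+1 | (a < q <= b)%N].

Lemma jump_interval (R : realType) (n : nat) (a b m : 'I_n) :
  (a < b)%N -> jump R (interval_set a b) m = (m == b)%:R - (m == a)%:R.
Proof.
move=> ab; rewrite /jump !inE /= /bump leq0n add1n ltnS -!val_eqE /=.
have [mb|bm|mb] := ltngtP m b; have [ma|am|ma] := ltngtP m a;
  rewrite /= ?subrr ?subr0 ?sub0r //; lia.
Qed.

(* The fence order generated by [k < k.+1] if the label between [k] and [k.+1]
   is on the lower chain and by [k.+1 < k] otherwise. *)
Definition fence (n : nat) (u : 'I_n.+1 -> bool) (a b : 'I_n) : Prop :=
  ((a < b)%N /\ forall q : 'I_n.+1, (a < q <= b)%N -> ~~ u q) \/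
  ((b < a)%N /\ forall q : 'I_n.+1, (b < q <= a)%N -> u q).

(** The jumps determine the set: an interval if [a < b], the complement of one otherwise. Comparing
    its elements with the two extreme coordinates, which lie outside the interval, imposes their
    signs; conversely these signs suffice because an interval is convex. *)
Lemma fence_jump (R : realType) (n : nat) (u : 'I_n.+1 -> bool) (a b : 'I_n) :
  a != b ->
  (exists2 S, S \in admissible u &
    forall m, jump R S m = (m == b)%:R - (m == a)%:R) <-> fence u a b.
Proof.
move=> ab.
have ends x y : ord0 \notin @interval_set n x y /\ ord_max \notin @interval_set n x y.
  by rewrite !inE /=; split=> //; have := ltn_ord y; lia.
have mem (x y : 'I_n) (q : 'I_n.+1) : (x < q <= y)%N ->
    q \in interval_set x y /\ ((ord0 : 'I_n.+1) < q < (ord_max : 'I_n.+1))%N.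
  by rewrite inE => /andP[xq qy]; rewrite xq qy (leq_trans _ xq) //= (leq_ltn_trans qy).
have det S T : S \in admissible u -> (forall m, jump R S m = jump R T m) -> S = T.
  move=> /admissible_proper[S0 ST] ST_eq.
  by apply: (@jump_proportional R n S T 1 1) => // m; rewrite ST_eq.
split.
  case=> S SF Sm; have /admissibleP[_ _ H] := SF.
  case: (ltngtP a b) => [lt|lt|/val_inj e]; last by rewrite e eqxx in ab.
  - have SE : S = interval_set a b by apply: (det _ _ SF) => m; rewrite Sm jump_interval.
    left; split=> // q /mem[qI q0n]; apply/negP => uq; have [i0 in_] := ends a b.
    have := H ord0 q ord_max q0n; rewrite uq SE qI (negbTE i0) (negbTE in_).
    by move=> /(_ erefl erefl).
  - have SE : S = ~: interval_set b a.
      by apply: (det _ _ SF) => m; rewrite Sm jumpC jump_interval // opprB.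
    right; split=> // q /mem[qI q0n]; apply: contraT => uq; have [i0 in_] := ends b a.
    have := H ord0 q ord_max q0n; rewrite uq SE !finset.in_setC qI i0 in_.
    by move=> /(_ erefl erefl).
have between (x y : 'I_n) (i j k : 'I_n.+1) : (i < j < k)%N ->
    i \in interval_set x y -> k \in interval_set x y -> j \in interval_set x y.
  by move=> /andP[ij jk]; rewrite !inE => /andP[xi iy] /andP[xk ky]; lia.
case=> -[lt H].
- exists (interval_set a b); last by move=> m; rewrite jump_interval.
  have [i0 in_] := ends a b; apply/admissibleP; split.
  + by exists (lift ord0 a); rewrite inE /= /bump leq0n add1n ltnSn.
  + by exists ord0.
  move=> i j k ijk; have [jI|jI] := boolP (j \in interval_set a b).
    by rewrite (H j) //; rewrite inE in jI.
  case: (u j) => //= iI kI; by rewrite (between a b i j k) in jI.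
- exists (~: interval_set b a); last by move=> m; rewrite jumpC jump_interval // opprB.
  have [i0 in_] := ends b a; apply/admissibleP; split.
  + by exists ord0; rewrite inE.
  + by exists (lift ord0 b); rewrite !inE negbK /= /bump leq0n add1n ltnSn.
  move=> i j k ijk; rewrite !finset.in_setC.
  have [jI|jI] := boolP (j \in interval_set b a).
    by rewrite (H j) //; rewrite inE in jI.
  case: (u j) => //= /negbFE iI /negbFE kI; by rewrite (between b a i j k) in jI.
Qed.

Lemma fence_adjacent (n : nat) (u : 'I_n.+1 -> bool) (k l : 'I_n) :
  l = k.+1 :> nat ->
  (fence u k l <-> ~~ u (lift ord0 k)) /\ (fence u l k <-> u (lift ord0 k)).
Proof.
move=> lk; have qE : lift ord0 k = k.+1 :> nat by [].
have one (q : 'I_n.+1) : (k < q <= l)%N -> q = lift ord0 k.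
  by move=> kql; apply: val_inj; rewrite /= -[RHS]/(lift ord0 k : nat) qE; lia.
have mem : (k < lift ord0 k <= l)%N by rewrite qE; lia.
split; split.
- by case=> -[lt H]; [exact: H | lia].
- by move=> uq; left; split=> [|q /one -> //]; lia.
- by case=> -[lt H]; [lia | exact: H].
- by move=> uq; right; split=> [|q /one -> //]; lia.
Qed.

(** The sign condition passes to subintervals, so a relation between distant positions factors
    through one next to the smaller index. *)
Lemma fence_split (n : nat) (u : 'I_n.+1 -> bool) (x y : 'I_n) :
  fence u x y -> x <> y.+1 :> nat -> y <> x.+1 :> nat ->
  exists z, [/\ z != x, z != y, fence u x z & fence u z y].
Proof.
case=> -[lt H] nxy nyx.
- have zn : (x.+1 < n)%N by apply: leq_trans (ltn_ord y); lia.
  exists (Ordinal zn); split; rewrite -?val_eqE /=; try lia;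
    by left; split=> [/=|q /= qz]; [lia | apply: H; lia].
- have zn : (y.+1 < n)%N by apply: leq_trans (ltn_ord x); lia.
  exists (Ordinal zn); split; rewrite -?val_eqE /=; try lia;
    by right; split=> [/=|q /= qz]; [lia | apply: H; lia].
Qed.

(** Adjacent positions form covering pairs: an intermediate [w] would lie beyond one of them, and
    the two relations would impose opposite signs on a common coordinate. *)
Lemma fence_adjacent_cover (n : nat) (u : 'I_n.+1 -> bool) (k l w : 'I_n) :
  l = k.+1 :> nat -> w != k -> w != l ->
  ~ (fence u k w /\ fence u w l) /\ ~ (fence u l w /\ fence u w k).
Proof.
move=> lk; rewrite -!val_eqE /= => /eqP wk /eqP wl.
have absurd (q : nat) (qn : (q < n.+1)%N) (A B : 'I_n.+1 -> bool) :
    (forall r, A r -> u r) -> (forall r, B r -> ~~ u r) -> A (Ordinal qn) ->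
    B (Ordinal qn) -> False.
  by move=> HA HB Ar Br; have := HB _ Br; rewrite HA.
have kn : (k < n.+1)%N by rewrite ltnS ltnW.
have wn : (w < n.+1)%N by rewrite ltnS ltnW.
by split=> -[[] [lt1 H1] [] [lt2 H2]]; try lia;
  [apply: (absurd w wn _ _ H2 H1) | apply: (absurd k kn _ _ H1 H2)
  | apply: (absurd w wn _ _ H2 H1) | apply: (absurd k kn _ _ H1 H2)] => /=; lia.
Qed.

(** By injectivity the values cannot turn back, so they move by constant steps of one, and the
    bounds on the range fix the starting point. *)
Lemma path_automorphism (n : nat) (tau : 'I_n -> 'I_n) :
  injective tau ->
  (forall k l : 'I_n, l = k.+1 :> nat ->
     tau l = (tau k).+1 :> nat \/ tau k = (tau l).+1 :> nat) ->
  (forall k, tau k = k) \/ (forall k, tau k = rev_ord k).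
Proof.
move=> tau_inj adj; case: n tau tau_inj adj => [|n] tau tau_inj adj.
  by left=> -[].
have val_inord k : (k <= n)%N -> (inord k : 'I_n.+1) = k :> nat.
  by move=> kn; rewrite inordK.
pose t k := nat_of_ord (tau (inord k)).
have tE (k : 'I_n.+1) : tau k = t k :> nat by rewrite /t inord_val.
have t_le k : (t k <= n)%N by rewrite -ltnS ltn_ord.
have t_adj k : (k < n)%N -> t k.+1 = (t k).+1 \/ t k = (t k.+1).+1.
  by move=> kn; apply: adj; rewrite !val_inord // ltnW.
have t_neq k : (k.+1 < n)%N -> t k.+2 <> t k.
  move=> kn /val_inj/tau_inj/(congr1 val); rewrite /= !val_inord //; lia.
have [n0|n_gt0] := posnP n.
  by left=> k; apply: val_inj; rewrite /= tE; have := t_le k; have := ltn_ord k; lia.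
have [up|down] := t_adj 0 n_gt0; [left|right].
- have lin k : (k < n)%N -> t k.+1 = (t 0 + k.+1)%N /\ t k = (t 0 + k)%N.
    elim: k => [|k IH] kn; first by rewrite up addn1 addn0.
    have [e1 e0] := IH (ltnW kn); split=> //.
    by have := t_neq k kn; have := t_adj k.+1 kn; lia.
  have t0 : t 0 = 0%N.
    have [|e _] := lin n.-1; first by rewrite prednK.
    move: e (t_le n); rewrite prednK // => ->.
    by rewrite -[leqRHS]add0n leq_add2r leqn0 => /eqP.
  move=> k; apply: val_inj; rewrite /= tE; have := ltn_ord k; rewrite ltnS => kn.
  have [kn'|nk] := ltnP k n; first by have [_ ->] := lin k kn'; rewrite t0.
  have -> : nat_of_ord k = n by lia.
  by have [] := lin n.-1; rewrite prednK ?t0.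
- have lin k : (k < n)%N -> (t k.+1 + k.+1 = t 0)%N /\ (t k + k = t 0)%N.
    elim: k => [|k IH] kn; first by rewrite down addn1 addn0.
    have [e1 e0] := IH (ltnW kn); split=> //.
    by have := t_neq k kn; have := t_adj k.+1 kn; lia.
  have t0 : t 0 = n.
    have [|e _] := lin n.-1; first by rewrite prednK.
    move: e (t_le 0); rewrite prednK // => <-.
    by rewrite -[leqRHS]add0n leq_add2r leqn0 => /eqP ->.
  move=> k; apply: val_inj; rewrite /= tE subSS; have := ltn_ord k; rewrite ltnS => kn.
  have [kn'|nk] := ltnP k n; first by have [_] := lin k kn'; rewrite t0; lia.
  have -> : nat_of_ord k = n by lia.
  by have [] := lin n.-1; rewrite prednK ?t0 //; lia.
Qed.

(** By counting, the induced injection of admissible sets is onto, so [tau] carries one fence order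
    to the other, reversed when [e] is true. It therefore preserves covering pairs and is an
    automorphism of the path; the relations between neighbours then give the signs. *)
Lemma signed_perm_signs (R : realType) (n : nat) (u u' : 'I_n.+1 -> bool)
    (tau : 'I_n -> 'I_n) (e : bool) :
  u ord0 = false -> u ord_max = false -> u' ord0 = false -> u' ord_max = false ->
  injective tau ->
  (forall S, S \in admissible u -> exists2 T, T \in admissible u' &
     forall k, jump R T (tau k) = (-1) ^+ e * jump R S k) ->
  (forall q : 'I_n.+1, (0 < q < n)%N -> u' q = u q (+) e) \/
  (forall q : 'I_n.+1, (0 < q < n)%N -> u' (rev_ord q) = ~~ u q (+) e).
Proof.
move=> u0 un u'0 u'n tau_inj Htau.
have sgn0 : (-1) ^+ e != 0 :> R by rewrite signr_eq0.
have image S : exists T, S \in admissible u -> T \in admissible u' /\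
    forall k, jump R T (tau k) = (-1) ^+ e * jump R S k.
  have [SF|] := boolP (S \in admissible u); last by exists S.
  by have [T TF ST] := Htau S SF; exists T.
have [phi phiP] := choice image.
have phi_inj : {in admissible u &, injective phi}.
  move=> S S' SF S'F E; have [S0 ST] := admissible_proper SF.
  apply: (@jump_proportional R n S S' 1 1) => // k; rewrite !mul1r.
  by apply: (mulfI sgn0); rewrite -(phiP S SF).2 -(phiP S' S'F).2 E.
have phi_onto : phi @: admissible u = admissible u'.
  apply/eqP; rewrite eqEcard card_in_imset // !card_admissible // leqnn andbT.
  by apply/fintype.subsetP => _ /imsetP[S SF ->]; case: (phiP S SF).
have tau_bij : bijective tau := injF_bij tau_inj.
have delta (a b k : 'I_n) : ((tau k == tau b)%:R - (tau k == tau a)%:R : R) =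
    (k == b)%:R - (k == a)%:R by rewrite !(inj_eq tau_inj).
(* With [e] true, w_b - w_a goes to the opposite difference. *)
pose fence' x y := if e then fence u' y x else fence u' x y.
have sgnB (x y : R) : (-1) ^+ e * (x - y) = if e then y - x else x - y.
  by case: (e); rewrite ?expr1 ?mulN1r ?opprB ?expr0 ?mul1r.
have fenceE a b : a != b -> fence u a b <-> fence' (tau a) (tau b).
  move=> ab; have tab : tau a != tau b by rewrite (inj_eq tau_inj).
  have -> : fence' (tau a) (tau b) <-> exists2 T, T \in admissible u' &
      forall k, jump R T (tau k) = (-1) ^+ e * ((k == b)%:R - (k == a)%:R).
    have ext (T : {set 'I_n.+1}) (x y : 'I_n) :
        (forall m, jump R T m = (m == tau y)%:R - (m == tau x)%:R) <->
        (forall k, jump R T (tau k) = (k == y)%:R - (k == x)%:R).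
      split=> [H k|H m]; first by rewrite H delta.
      by case: tau_bij => g _ gK; rewrite -(gK m) H delta.
    rewrite /fence'; case: (e) sgnB => sgnB.
      rewrite -(fence_jump R u' (a := tau b)) 1?eq_sym //.
      by split=> -[T TF HT]; exists T => //;
        [move/ext: HT => HT k; rewrite sgnB HT | apply/ext => k; rewrite HT sgnB].
    rewrite -(fence_jump R u' tab).
    by split=> -[T TF HT]; exists T => //;
      [move/ext: HT => HT k; rewrite sgnB HT | apply/ext => k; rewrite HT sgnB].
  rewrite -(fence_jump R u ab); split=> [[S SF HS]|[T TF HT]].
    by exists (phi S); [case: (phiP S SF) | move=> k; rewrite (phiP S SF).2 HS].
  rewrite -phi_onto in TF; have [S SF TE] := imsetP TF.
  by exists S => // k; apply: (mulfI sgn0); rewrite -HT TE (phiP S SF).2.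
(* If the images were not neighbours, [fence_split] would insert a position between them, whose
   preimage would contradict [fence_adjacent_cover]. *)
have cover (k l : 'I_n) : l = k.+1 :> nat ->
    tau l = (tau k).+1 :> nat \/ tau k = (tau l).+1 :> nat.
  move=> lk; have kl : k != l by rewrite -val_eqE /= lk ltn_eqF.
  have [|no] := pselect (tau l = (tau k).+1 :> nat \/ tau k = (tau l).+1 :> nat) => //.
  have [nlk nkl] : tau l <> (tau k).+1 :> nat /\ tau k <> (tau l).+1 :> nat.
    by split=> E; apply: no; [left|right].
  have split' x y : fence' (tau x) (tau y) -> tau x <> (tau y).+1 :> nat ->
      tau y <> (tau x).+1 :> nat ->
      exists w, [/\ w != x, w != y, fence u x w & fence u w y].
    move=> F nxy nyx; have [z [zx zy Fxz Fzy]] : exists z,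
        [/\ z != tau x, z != tau y, fence' (tau x) z & fence' z (tau y)].
      rewrite /fence' in F *; case: (e) F => F.
        by have [z [? ? ? ?]] := fence_split F nyx nxy; exists z.
      exact: fence_split F nxy nyx.
    case: tau_bij => g _ gK; rewrite -(gK z) !(inj_eq tau_inj) in zx zy Fxz Fzy.
    by exists (g z); split=> //; apply/fenceE; rewrite // eq_sym.
  case: (boolP (u (lift ord0 k))) => uk; exfalso.
    have /fenceE F : fence u l k by apply/(fence_adjacent u lk).2.
    have [|w [wl wk Flw Fwk]] := split' l k (F _) nlk nkl; first by rewrite eq_sym.
    by case: (fence_adjacent_cover u lk wk wl) => _; apply.
  have /fenceE F : fence u k l by apply/(fence_adjacent u lk).1.
  have [w [wk wl Fkw Fwl]] := split' k l (F kl) nkl nlk.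
  by case: (fence_adjacent_cover u lk wk wl) => + _; apply.
have lower (k l : 'I_n) : l = k.+1 :> nat ->
    ~~ u (lift ord0 k) <-> fence' (tau k) (tau l).
  move=> lk; rewrite -fenceE; last by rewrite -val_eqE /= lk ltn_eqF.
  by split=> /(fence_adjacent u lk).1.
(* The coordinate [q] separates [k] and [l], and its mirror image separates [rev_ord l] and
   [rev_ord k]. *)
have pos (q : 'I_n.+1) : (0 < q < n)%N -> exists k l : 'I_n,
    [/\ l = k.+1 :> nat, q = lift ord0 k & rev_ord q = lift ord0 (rev_ord l)].
  move=> /andP[q0 qn]; have q1 : (q.-1 < n)%N by lia.
  exists (Ordinal q1), (Ordinal qn); split; first by rewrite /= prednK.
    by apply: val_inj; rewrite /= /bump leq0n add1n prednK.
  by apply: val_inj; rewrite /= /bump leq0n add1n; lia.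
have iffb (b c : bool) : (b <-> c) -> b = c.
  by case=> bc cb; apply/idP/idP.
have [tauE|tauE] := path_automorphism tau_inj cover; [left|right];
  move=> q /pos[k [l [lk qE rqE]]].
- have := lower k l lk; rewrite !tauE -qE /fence'.
  have [F1 F2] := fence_adjacent u' lk; rewrite -qE in F1 F2.
  case: (e) => H; last by rewrite addbF; apply: negb_inj; apply: iffb; rewrite H F1.
  by rewrite addbT; apply: iffb; rewrite H F2.
- have := lower k l lk; rewrite !tauE -qE /fence'.
  have lk' : rev_ord k = (rev_ord l).+1 :> nat by rewrite /=; have := ltn_ord l; lia.
  have [F1 F2] := fence_adjacent u' lk'; rewrite -rqE in F1 F2.
  case: (e) => H; last by rewrite addbF; apply: iffb; rewrite H F2.
  by rewrite addbT; apply: negb_inj; rewrite negbK; apply: iffb; rewrite H F1.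
Qed.

(** * Reversal and negation *)

Lemma isometric_trans (R : realType) (d : nat) (P Q S : set 'rV[R]_d) :
  isometric P Q -> isometric Q S -> isometric P S.
Proof.
case=> f f_iso <- [g g_iso <-]; exists (g \o f); last by rewrite image_comp.
by move=> x y; rewrite /= g_iso f_iso.
Qed.

Lemma isometric_involution (R : realType) (d : nat) (P Q : set 'rV[R]_d)
    (g : 'rV[R]_d -> 'rV[R]_d) :
  (forall x y, eucl_dist (g x) (g y) = eucl_dist x y) -> involutive g ->
  (forall x, P x -> Q (g x)) -> (forall x, Q x -> P (g x)) -> isometric P Q.
Proof.
move=> g_iso gK PQ QP; exists g => //; apply/seteqP.
by split=> [_ [x Px <-]|x Qx]; [exact: PQ | exists (g x); [exact: QP | exact: gK]].
Qed.

(** Point reflection in the centre of the permutahedron exchanges the inequality of [S] with that of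
    its complement. *)
Lemma isometric_compl (R : realType) (n : nat) (Fam Fam' : {set {set 'I_n.+1}}) :
  (forall S, (S \in Fam) = (~: S \in Fam')) ->
  isometric (cut_polytope R Fam) (cut_polytope R Fam').
Proof.
move=> FF'; pose g (x : 'rV[R]_n.+1) := const_mx n.+2%:R - x.
have sum_g S x : coord_sum S (g x) = #|S|%:R * n.+2%:R - coord_sum S x.
  rewrite /g linearB /=; congr (_ - _); rewrite /coord_sum.
  by under eq_bigr do rewrite mxE; rewrite sumr_const mulr_natl.
have map (F F' : {set {set 'I_n.+1}}) x : (forall S, S \in F' -> ~: S \in F) ->
    cut_polytope R F x -> cut_polytope R F' (g x).
  move=> F'F /cut_polytopeP[Hx xT]; apply/cut_polytopeP; split; last first.
    rewrite sum_g xT cardsT card_ord /triangular -[n.+2]addn1 natrD.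
    by field.
  move=> S /F'F/Hx; have : coord_sum S x + coord_sum (~: S) x = triangular R n.+1.
    rewrite -xT /coord_sum [in RHS](big_setID S) /= finset.setTI.
    by congr (_ + _); apply: eq_bigl => k; rewrite !inE andbT.
  have : #|S|%:R + #|~: S|%:R = n.+1%:R :> R by rewrite -natrD cardsC card_ord.
  rewrite sum_g /triangular -[n.+2]addn1 natrD => cE sE.
  have -> : #|~: S|%:R = n.+1%:R - #|S|%:R :> R by rewrite -cE addrAC subrr add0r.
  have -> : coord_sum (~: S) x =
      2^-1 * n.+1%:R * (n.+1%:R + 1) - coord_sum S x :> R.
    by rewrite -sE addrAC subrr add0r.
  by nra.
apply: (@isometric_involution _ _ _ _ g).
- move=> x y; rewrite /eucl_dist; congr Num.sqrt; apply: eq_bigr => i _.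
  by rewrite !mxE; ring.
- by move=> x; rewrite /g opprB addrC subrK.
- by move=> x; apply: map => S; rewrite FF' finset.setCK.
- by move=> x; apply: map => S; rewrite FF'.
Qed.

Lemma isometric_rev (R : realType) (n : nat) (Fam Fam' : {set {set 'I_n.+1}}) :
  (forall S, (S \in Fam) = (@rev_ord n.+1 @: S \in Fam')) ->
  isometric (cut_polytope R Fam) (cut_polytope R Fam').
Proof.
move=> FF'; pose g (x : 'rV[R]_n.+1) := \row_k x 0 (rev_ord k).
have rev_inj := @rev_ord_inj n.+1.
have revK (S : {set 'I_n.+1}) : @rev_ord n.+1 @: (@rev_ord n.+1 @: S) = S.
  rewrite -imset_comp -[RHS]imset_id; apply: eq_imset => k; exact: rev_ordK.
have sum_g S x : coord_sum S (g x) = coord_sum (@rev_ord n.+1 @: S) x.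
  rewrite /coord_sum big_imset /=; last by move=> i j _ _; exact: rev_inj.
  by apply: eq_bigr => k _; rewrite mxE.
have map (F F' : {set {set 'I_n.+1}}) x :
    (forall S, S \in F' -> @rev_ord n.+1 @: S \in F) ->
    cut_polytope R F x -> cut_polytope R F' (g x).
  move=> F'F /cut_polytopeP[Hx xT]; apply/cut_polytopeP; split; last first.
    rewrite sum_g -xT; congr coord_sum; apply/eqP.
    by rewrite eqEcard finset.subsetT card_imset //= ?leqnn.
  by move=> S /F'F/Hx; rewrite sum_g card_imset.
apply: (@isometric_involution _ _ _ _ g).
- move=> x y; rewrite /eucl_dist; congr Num.sqrt.
  rewrite [RHS](reindex_inj rev_inj); apply: eq_bigr => i _.
  by rewrite !mxE.
- by move=> x; apply/rowP => k; rewrite !mxE rev_ordK.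
- by move=> x; apply: map => S; rewrite FF' revK.
- by move=> x; apply: map => S; rewrite FF'.
Qed.

Lemma admissible_ext (n : nat) (u u' : 'I_n.+1 -> bool) :
  (forall q : 'I_n.+1, (0 < q < n)%N -> u q = u' q) -> admissible u = admissible u'.
Proof.
move=> E; apply/setP => S; apply/admissibleP/admissibleP => -[in_ out H];
  split=> // i j k ijk.
  by rewrite -E; [exact: H | have := ltn_ord k; lia].
by rewrite E; [exact: H | have := ltn_ord k; lia].
Qed.

Lemma admissibleC (n : nat) (u : 'I_n.+1 -> bool) (S : {set 'I_n.+1}) :
  (S \in admissible u) = (~: S \in admissible (fun q => ~~ u q)).
Proof.
apply/admissibleP/admissibleP => -[[a aS] [b bS] H].
  split; [by exists b; rewrite inE | by exists a; rewrite inE negbK |].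
  move=> i j k ijk; rewrite !inE => /negb_inj iS /negb_inj kS; congr negb.
  exact: H ijk iS kS.
rewrite !inE in aS bS; rewrite negbK in bS.
split; [by exists b | by exists a |] => i j k ijk iS kS.
by have := H i j k ijk; rewrite !inE iS kS => /(_ erefl erefl)/negb_inj.
Qed.

Lemma admissible_rev (n : nat) (u : 'I_n.+1 -> bool) (S : {set 'I_n.+1}) :
  (S \in admissible u) =
  (@rev_ord n.+1 @: S \in admissible (fun q => u (rev_ord q))).
Proof.
have mem (T : {set 'I_n.+1}) q : (q \in @rev_ord n.+1 @: T) = (rev_ord q \in T).
  by rewrite -{1}(rev_ordK q) mem_imset //; exact: rev_ord_inj.
have flip (i j k : 'I_n.+1) : (i < j < k)%N -> (rev_ord k < rev_ord j < rev_ord i)%N.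
  by have := ltn_ord k; rewrite /= !subSS; lia.
apply/admissibleP/admissibleP => -[[a aS] [b bS] H].
  split; [by exists (rev_ord a); rewrite mem rev_ordK
         | by exists (rev_ord b); rewrite mem rev_ordK |].
  by move=> i j k /flip ijk; rewrite !mem => iS kS; apply: H ijk kS iS.
rewrite mem in aS; rewrite mem in bS.
split; [by exists (rev_ord a) | by exists (rev_ord b) |].
move=> i j k /flip ijk iS kS; have := H _ _ _ ijk.
by rewrite !mem !rev_ordK => /(_ kS iS).
Qed.

Lemma isometric_of_signs (R : realType) (n : nat) (u u' : 'I_n.+1 -> bool) (e : bool) :
  (forall q : 'I_n.+1, (0 < q < n)%N -> u' q = u q (+) e) ->
  isometric (cut_polytope R (admissible u)) (cut_polytope R (admissible u')).
Proof.
move=> E; case: e E => E.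
  (* Negation also flips the two extreme signs, which the admissible family ignores. *)
  rewrite -(@admissible_ext _ (fun q => ~~ u q) u') => [|q /E ->]; last by case: (u q).
  by apply: isometric_compl; exact: admissibleC.
rewrite -(@admissible_ext _ u u') => [|q /E ->]; last by case: (u q).
by exists id => //; rewrite image_id.
Qed.

Lemma normally_isomorphic_isometric (R : realType) (n : nat)
    (u u' : 'I_n.+1 -> bool) :
  u ord0 = false -> u ord_max = false -> u' ord0 = false -> u' ord_max = false ->
  normally_isomorphic (cut_polytope R (admissible u))
    (cut_polytope R (admissible u')) ->
  isometric (cut_polytope R (admissible u)) (cut_polytope R (admissible u')).
Proof.
move=> u0 un u'0 u'n /normally_isomorphic_signed_perm[tau [e [tau_inj H]]].
case: (signed_perm_signs u0 un u'0 u'n tau_inj H); first exact: isometric_of_signs.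
(* Reversing the coordinates accounts for [rev_ord]; since it also reverses the direction between
   neighbours, the remaining sign change is [~~ e]. *)
move=> rev; apply: (@isometric_trans _ _ _
    (cut_polytope R (admissible (fun q => u (rev_ord q))))).
  by apply: isometric_rev; exact: admissible_rev.
apply: (@isometric_of_signs R n _ _ (~~ e)) => q qn.
have := rev (rev_ord q); rewrite rev_ordK => ->; first by rewrite addbN addNb.
by rewrite /=; lia.
Qed.

(** * Isometries preserve normal fans *)

Definition dot (R : realType) (d : nat) (x y : 'rV[R]_d) : R :=
  \sum_(i < d) x 0 i * y 0 i.

Lemma dot_deltar (R : realType) (d : nat) (x : 'rV[R]_d) (j : 'I_d) :
  dot x (delta_mx 0 j) = x 0 j.
Proof.
rewrite /dot (bigD1 j) //= big1 => [|i ij]; rewrite mxE eqxx /=.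
  by rewrite eqxx mulr1 addr0.
by rewrite (negbTE ij) mulr0.
Qed.

Lemma dotBB (R : realType) (d : nat) (x y : 'rV[R]_d) :
  dot (x - y) (x - y) = dot x x + dot y y - 2 * dot x y.
Proof.
rewrite /dot mulr_sumr -big_split /= -sumrB; apply: eq_bigr => i _.
by rewrite !mxE; ring.
Qed.

(** After translation to fix the origin, [g] preserves norms, hence scalar products by polarization.
    The rows of [A] are the images of the unit vectors, and linearity follows from recovering [x] by
    scalar products with them. *)
Lemma isometry_affine (R : realType) (d : nat) (g : 'rV[R]_d -> 'rV[R]_d) :
  (forall x y, eucl_dist (g x) (g y) = eucl_dist x y) ->
  exists2 A : 'M[R]_d, A *m A^T = 1%:M & forall x, g x = x *m A + g 0.
Proof.
move=> g_iso; pose h x := g x - g 0.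
have dist2 x y : dot (g x - g y) (g x - g y) = dot (x - y) (x - y).
  have sqE (a b : 'rV[R]_d) : dot (a - b) (a - b) = eucl_dist a b ^+ 2.
    rewrite sqr_sqrtr ?sumr_ge0 // => [|i _]; last exact: sqr_ge0.
    by apply: eq_bigr => i _; rewrite !mxE expr2.
  by rewrite !sqE g_iso.
have hnorm x : dot (h x) (h x) = dot x x by rewrite dist2 subr0.
have hdot x y : dot (h x) (h y) = dot x y.
  have hB : h x - h y = g x - g y by rewrite /h opprB addrA subrK.
  have : dot (h x - h y) (h x - h y) = dot (x - y) (x - y) by rewrite hB dist2.
  by rewrite (dotBB (h x)) (dotBB x) !hnorm; lra.
pose A := \matrix_i h (delta_mx 0 i).
have mulA x : h x *m A^T = x.
  apply/rowP => j; rewrite mxE -[RHS]dot_deltar -hdot.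
  by apply: eq_bigr => i _; rewrite !mxE.
have AAT : A *m A^T = 1%:M.
  apply/row_matrixP => i; rewrite row_mul rowK mulA.
  by apply/rowP => j; rewrite !mxE eqxx eq_sym.
exists A => // x; rewrite -{2}(mulA x) -mulmxA (mulmx1C AAT) mulmx1.
by rewrite /h subrK.
Qed.

(** * Pullback of functionals along maps of direction spaces *)

Definition precomp (R : realType) (V W : vectType R) (h : 'Hom(W, V))
    (c : 'Hom(V, R^o)) : 'Hom(W, R^o) := (c \o h)%VF.

Fact precomp_is_linear (R : realType) (V W : vectType R) (h : 'Hom(W, V)) :
  linear (precomp h).
Proof. by move=> a c c'; rewrite /precomp comp_lfunDl comp_lfunZl. Qed.

HB.instance Definition _ (R : realType) (V W : vectType R) (h : 'Hom(W, V)) :=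
  GRing.isLinear.Build R 'Hom(V, R^o) 'Hom(W, R^o) _ (precomp h)
    (precomp_is_linear h).

(** The projection makes this map total; it is the restriction of [A] once [A] sends one direction
    space into the other, as in [dir_mapE]. *)
Definition dir_map (R : realType) (d : nat) (P Q : set 'rV[R]_d) (A : 'M[R]_d) :
    'Hom(subvs_of (dirspace P), subvs_of (dirspace Q)) :=
  (linfun (vsproj (dirspace Q)) \o
     (linfun (mulmxr A) \o linfun (vsval (U := dirspace P))))%VF.

(** The preimage of [dirspace Q] contains all differences of points of [P], so minimality of
    [dirspace P] applies. *)
Lemma dirspace_mulmx (R : realType) (d : nat) (P Q : set 'rV[R]_d)
    (A : 'M[R]_d) (b v : 'rV[R]_d) :
  (forall x, P x -> Q (x *m A + b)) -> v \in dirspace P -> v *m A \in dirspace Q.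
Proof.
move=> PQ; have [_ Pmin] := dirspaceP P; have [Qin _] := dirspaceP Q.
suff /subvP sub : (dirspace P <= linfun (mulmxr A) @^-1: dirspace Q)%VS.
  by move=> /sub; rewrite -memv_preim lfunE.
apply: Pmin => x y Px Py; rewrite -memv_preim lfunE /= mulmxBl.
have := Qin _ _ (PQ x Px) (PQ y Py).
by rewrite opprD addrACA subrr addr0.
Qed.

Lemma dir_mapE (R : realType) (d : nat) (P Q : set 'rV[R]_d)
    (A : 'M[R]_d) (b v : 'rV[R]_d) :
  (forall x, P x -> Q (x *m A + b)) -> v \in dirspace P ->
  dir_map P Q A (vsproj _ v) = vsproj _ (v *m A).
Proof. by move=> PQ vP; rewrite /dir_map !comp_lfunE !lfunE /= vsprojK. Qed.

(** Faces go to faces, and functionals are carried along by precomposition with the inverse linear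
    part, which is the transpose. *)
Lemma isometric_normally_isomorphic (R : realType) (d : nat)
    (P Q : set 'rV[R]_d) :
  isometric P Q -> normally_isomorphic P Q.
Proof.
case=> g /isometry_affine[A AAT gE] gPQ; set b := g 0 in gE.
have ATA := mulmx1C AAT.
have PQ x : P x -> Q (x *m A + b) by move=> Px; rewrite -gPQ -gE; exists x.
have QP x : Q x -> P (x *m A^T + - (b *m A^T)).
  by rewrite -gPQ => -[y Py <-]; rewrite gE mulmxDl -mulmxA AAT mulmx1 addrK.
have dirK (P1 Q1 : set 'rV[R]_d) (B C : 'M[R]_d) (b1 c1 : 'rV[R]_d) :
    (forall x, P1 x -> Q1 (x *m B + b1)) -> (forall x, Q1 x -> P1 (x *m C + c1)) ->
    B *m C = 1%:M -> cancel (precomp (dir_map Q1 P1 C)) (precomp (dir_map P1 Q1 B)).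
  move=> P1Q1 Q1P1 BC c; apply/lfunP => v; rewrite -(vsvalK v).
  have vP := subvsP v; rewrite /precomp 2!comp_lfunE (dir_mapE P1Q1) //.
  by rewrite (dir_mapE Q1P1) ?(dirspace_mulmx P1Q1) // -mulmxA BC mulmx1.
have precompE c x y : P x -> P y ->
    precomp (dir_map Q P A^T) c (vsproj (dirspace Q) (g y - g x)) =
    c (vsproj (dirspace P) (y - x)).
  move=> Px Py; have [Pin _] := dirspaceP P.
  have -> : g y - g x = (y - x) *m A.
    by rewrite !gE mulmxBl opprD addrACA subrr addr0.
  rewrite /precomp comp_lfunE (dir_mapE QP) -?mulmxA ?AAT ?mulmx1 //.
  by apply: (dirspace_mulmx PQ); exact: Pin.
have PQK := dirK P Q A A^T b _ PQ QP AAT.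
have QPK := dirK Q P A^T A _ b QP PQ ATA.
have linE c : linfun (precomp (dir_map Q P A^T)) c = precomp (dir_map Q P A^T) c.
  by rewrite lfunE.
exists (linfun (precomp (dir_map Q P A^T))).
  exists (linfun (precomp (dir_map P Q A))) => c; rewrite !lfunE /=.
    exact: PQK.
  exact: QPK.
move=> C [F [[x0 Fx0] [c0 FE]] ->]; exists [set g x | x in F].
  split; first by exists (g x0), x0.
  (* On image points this functional differs from [c0] by a constant, so it is maximal at the images
     of the same points. *)
  exists (c0 \o linfun (mulmxr A^T))%VF.
  have c0E x : (c0 \o linfun (mulmxr A^T))%VF (g x) = c0 x + c0 (b *m A^T).
    by rewrite comp_lfunE lfunE /= gE mulmxDl -mulmxA AAT mulmx1 linearD.
  apply/seteqP; split=> [_ [x Fx <-]|z [+ +]].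
    move: Fx; rewrite FE => -[Px cx]; split; first by rewrite -gPQ; exists x.
    by rewrite -gPQ => _ [y Py <-]; rewrite !c0E lerD2r cx.
  rewrite -gPQ => -[x Px <-] cx; exists x => //; rewrite FE; split=> // y Py.
  by have := cx (g y); rewrite !c0E lerD2r; apply; exists y.
have FP x : F x -> P x by rewrite FE => -[].
apply/seteqP; split=> [_ [c Hc <-]|c Hc].
  move=> x1 y1 [x Fx <-] Qy1.
  have [z Pz <-] : [set g x | x in P] y1 by rewrite gPQ.
  by rewrite linE precompE ?Hc //; exact: FP.
exists (precomp (dir_map P Q A) c); last first.
  by rewrite linE; exact: QPK.
move=> x y Fx Py; rewrite -(precompE (precomp (dir_map P Q A) c) _ _ (FP x Fx) Py).
have -> := QPK c.
by apply: Hc; [exists x | rewrite -gPQ; exists y].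
Qed.

Theorem proposition4p11 (R : realType) (n : nat) (hn : (1 <= n)%N)
  (sigma sigma' : (n.-1).-tuple bool)
  (p p' : 'I_n.+3 -> 'rV[R]_2)
  (hp : is_polygon sigma p) (hp' : is_polygon sigma' p') :
  normally_isomorphic (AssI p) (AssI p') <-> isometric (AssI p) (AssI p').
Proof.
split; last exact: isometric_normally_isomorphic.
rewrite (AssI_cut_polytope hn hp) (AssI_cut_polytope hn hp').
(* The extreme coordinates carry the labels 1 and n + 1, both of negative sign. *)
apply: normally_isomorphic_isometric; rewrite /coord_sign //=;
  exact: upper_penultimate.
Qed.
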